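(* Let $(V,\omega)$ be a vertex operator algebra with an automorphism $g$ of finite order $T$, and let $n,m\in(1/T)\mathbb N$. Then (1) the associative algebras $\tilde A_{g,n}(V,\omega)$ and $A_{g,n}(V,\omega)$ are isomorphic; (2) the $\tilde A_{g,n}(V,\omega)$–$\tilde A_{g,m}(V,\omega)$-bimodule $\tilde A_{g,n,m}(V,\omega)$ and the $A_{g,n}(V,\omega)$–$A_{g,m}(V,\omega)$-bimodule $A_{g,n,m}(V,\omega)$ are isomorphic (i.e. there is a linear isomorphism between them intertwining the actions via algebra isomorphisms as in (1)).
   Context: A vertex operator algebra $(V,Y,\mathbf 1,\omega)$ is a vertex algebra with $V=\bigoplus_{n\in\mathbb Z}V_n$, $\dim V_n<\infty$, $V_n=0$ for $n\ll0$, $\omega\in V_2$, $L(m)=\omega_{m+1}$ satisfying the Virasoro relations, $L(0)|_{V_n}=n$, $Y(L(-1)w,z)=\frac d{dz}Y(w,z)$; $\mathrm{wt}\,u=n$ for $u\in V_n$. An automorphism $g$ is a vertex algebra automorphism with $g\omega=\omega$; $V^r=\{v:gv=e^{-2\pi\sqrt{-1}r/T}v\}$. $\tilde A_{g,n}(V,\omega)$, $\tilde A_{g,n,m}(V,\omega)$ denote the constructions below applied to the underlying vertex algebra $(V,Y,\mathbf 1)$ (where $\mathcal Dv=v_{-2}\mathbf 1=L(-1)v$). For $k,l\in\{0,\dots,T-1\}$, $\delta_k(l)=1$ if $k\ge l$, $0$ if $k<l$, $\delta_k(T)=0$; $n=\lfloor n\rfloor+\bar n/T$. $(1+z)^\alpha$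 is expanded in nonnegative powers of $z$. Vertex algebra side: for $u\in V^r$, $v\in V$, $m,n,p\in(1/T)\mathbb N$, $\bar p-\bar n\equiv r$: $u\bullet_{g,m,p}^{\,n}v=\sum_{i=0}^{\lfloor p\rfloor}(-1)^i\binom{\lfloor m\rfloor+\lfloor n\rfloor-\lfloor p\rfloor-1+\delta_{\bar m}(r)+\delta_{\bar n}(T-r)+i}{i}\operatorname{Res}_y\frac{(1+y)^{-1+\lfloor m\rfloor+\delta_{\bar m}(r)+r/T}}{y^{\lfloor m\rfloor+\lfloor n\rfloor-\lfloor p\rfloor+\delta_{\bar m}(r)+\delta_{\bar n}(T-r)+i}}Y(u,\log(1+y))v$, else $0$; $u\diamond_{g,m}^{\,n}v=\operatorname{Res}_y\frac{(1+y)^{-1+\delta_{\bar m}(r)+\lfloor m\rfloor+r/T}}{y^{\lfloor m\rfloor+\lfloor n\rfloor+\delta_{\bar m}(r)+\delta_{\bar n}(T-r)+1}}Y(u,\log(1+y))v$; $\tilde O'_{g,n,m}=\mathrm{span}\{u\diamond_{g,m}^{\,n}v\}+\mathrm{span}\{(\mathcal D+m-n)u\}$; $\tilde O''_{g,n,m}$ = span of all $u\bullet_{g,m,p_3}^{\,n}\big((a\bullet_{g,p_1,p_2}^{\,p_3}b)\bullet_{g,m,p_1}^{\,p_3}c-a\bullet_{g,m,p_2}^{\,p_3}(b\bullet_{g,m,p_1}^{\,p_2}c)\big)$; $\tilde O'''_{g,n,m}=\sum_{p_1,p_2}(V\bullet_{g,p_1,p_2}^{\,n}\tilde O'_{g,p_2,p_1})\bullet_{g,m,p_1}^{\,n}V$;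 $\tilde O_{g,n,m}=\tilde O'+\tilde O''+\tilde O'''$; $\tilde O_{g,n}=\tilde O'_{g,n,n}$; $\tilde A_{g,n}=V/\tilde O_{g,n}$ with product $\bullet_{g,n,n}^{\,n}$; $\tilde A_{g,n,m}=V/\tilde O_{g,n,m}$, left action $\bullet_{g,m,n}^{\,n}$, right action $\bullet_{g,m,m}^{\,n}$. VOA side: for homogeneous $u\in V^r$, $\bar p-\bar n\equiv r$: $u*_{g,m,p}^{\,n}v=\sum_{i=0}^{\lfloor p\rfloor}(-1)^i\binom{\lfloor m\rfloor+\lfloor n\rfloor-\lfloor p\rfloor-1+\delta_{\bar m}(r)+\delta_{\bar n}(T-r)+i}{i}\operatorname{Res}_z\frac{(1+z)^{\mathrm{wt}u-1+\lfloor m\rfloor+\delta_{\bar m}(r)+r/T}}{z^{\lfloor m\rfloor+\lfloor n\rfloor-\lfloor p\rfloor+\delta_{\bar m}(r)+\delta_{\bar n}(T-r)+i}}Y(u,z)v$, else $0$; $u\circ_{g,m}^{\,n}v=\operatorname{Res}_z\frac{(1+z)^{\mathrm{wt}u-1+\lfloor m\rfloor+\delta_{\bar m}(r)+r/T}}{z^{\lfloor m\rfloor+\lfloor n\rfloor+\delta_{\bar m}(r)+\delta_{\bar n}(T-r)+1}}Y(u,z)v$; $O'_{g,n,m}=\mathrm{span}\{u\circ_{g,m}^{\,n}v\}+\mathrm{span}\{(L(-1)+L(0)+m-n)u\}$; $O''_{g,n,m}$, $O'''_{g,n,m}$, $O_{g,n,m}$ as on the vertex algebra side with $*$ and $O'$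 in place of $\bullet$ and $\tilde O'$; $O_{g,n}=O'_{g,n,n}$; $A_{g,n}(V,\omega)=V/O_{g,n}$ with product $*_{g,n,n}^{\,n}$ (an associative algebra); $A_{g,n,m}(V,\omega)=V/O_{g,n,m}$, left action $*_{g,m,n}^{\,n}$, right action $*_{g,m,m}^{\,n}$. *)

(* Defs.v *)
From Stdlib Require Import ClassicalEpsilon.
From HB Require Import structures.
From mathcomp Require Import all_boot all_order all_algebra.
Set Implicit Arguments. Unset Strict Implicit. Unset Printing Implicit Defensive.
Import Order.TTheory GRing.Theory Num.Theory.
Local Open Scope ring_scope.

Section Generic.
Variables (K : fieldType) (V : lmodType K).

Definition binK (a : K) (i : nat) : K :=
  (\prod_(j < i) (a - j%:R)) / (i`!)%:R.

(* Sum over integers n >= lo of an eventually vanishing family f n.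
   (Classical choice of a truncation point; the value does not depend on it.
   If f is not eventually 0 the value is 0, which never happens below.) *)
Definition esum (lo : int) (f : int -> V) : V :=
  match excluded_middle_informative
          (exists N : nat, forall i : nat, (N <= i)%N -> f (lo + i%:Z) = 0) with
  | left H => let N := proj1_sig (constructive_indefinite_description _ H) in
              \sum_(i < N) f (lo + i%:Z)
  | right _ => 0
  end.

(* Formal power series in y, as coefficient functions *)
Definition psmul (f h : nat -> K) : nat -> K :=
  fun k => \sum_(i < k.+1) f i * h (k - i)%N.
Definition ps1 : nat -> K := fun k => if k == 0%N then 1 else 0.
Definition psexp (f : nat -> K) (e : nat) : nat -> K := iter e (psmul f) ps1.
(* inverse of a power series with constant coefficient 1 *)
Fixpoint inv_list (f : nat -> K) (k : nat) : seq K :=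
  match k with
  | 0 => [::]
  | k'.+1 => let s := inv_list f k' in
      rcons s (if k' == 0%N then 1
               else - \sum_(j < k') f j.+1 * nth 0 s (k' - j.+1)%N)
  end.
Definition psinv (f : nat -> K) : nat -> K := fun k => nth 0 (inv_list f k.+1) k.
(* lambda(y) = log(1+y)/y = sum_k (-1)^k y^k/(k+1) *)
Definition lam : nat -> K := fun k => (-1) ^+ k / (k.+1)%:R.
Definition lampow (e : int) : nat -> K :=
  match e with
  | Posz k => psexp lam k
  | Negz k => psexp (psinv lam) k.+1
  end.

Inductive inspan (S : V -> Prop) : V -> Prop :=
| inspan0 : inspan S 0
| inspanD (x y : V) (a : K) : S x -> inspan S y -> inspan S (a *: x + y).

Definition linearP (f : V -> V) := forall (a : K) (x y : V), f (a *: x + y) = a *: f x + f y.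

(* Isomorphism V/O1 -> V/O2 induced by a linear map f : V -> V *)
Definition quot_iso (O1 O2 : V -> Prop) (f : V -> V) : Prop :=
  [/\ linearP f,
      forall x, O1 x -> O2 (f x),
      forall x, O2 (f x) -> O1 x &
      forall y, exists x, O2 (f x - y)].

Definition alg_iso (O1 O2 : V -> Prop) (p1 p2 : V -> V -> V) (f : V -> V) : Prop :=
  quot_iso O1 O2 f /\ forall u v, O2 (f (p1 u v) - p2 (f u) (f v)).

Definition bimod_iso (M1 M2 : V -> Prop) (l1 r1 l2 r2 : V -> V -> V)
    (fl fr h : V -> V) : Prop :=
  [/\ quot_iso M1 M2 h,
      forall a x, M2 (h (l1 a x) - l2 (fl a) (h x)) &
      forall x b, M2 (h (r1 x b) - r2 (h x) (fr b))].

Variables (Y : V -> int -> V -> V) (one : V).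

Definition is_vertex_algebra : Prop :=
  (forall n a u u' v, Y (a *: u + u') n v = a *: Y u n v + Y u' n v) /\
  (forall n a u v v', Y u n (a *: v + v') = a *: Y u n v + Y u n v') /\
  (forall u v, exists N : int, forall n, N <= n -> Y u n v = 0) /\
  (forall n v, Y one n v = (if n == -1 then v else 0)) /\
  (forall u, Y u (-1) one = u /\ forall n, 0 <= n -> Y u n one = 0) /\
  (* Borcherds (Jacobi) identity; the sums are finite *)
  (forall u v w (p q r : int), exists N : nat, forall M : nat, (N <= M)%N ->
        \sum_(i < M) binK p%:~R i *: Y (Y u (r + i%:Z) v) (p + q - i%:Z) w =
        \sum_(i < M) ((-1) ^+ i * binK r%:~R i) *:
            (Y u (p + r - i%:Z) (Y v (q + i%:Z) w)
             - (-1) ^ r *: Y v (q + r - i%:Z) (Y u (p + i%:Z) w))).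

Variable (om : V) (c : K).
Definition Lop (k : int) (v : V) : V := Y om (k + 1) v.
Definition wt_space (k : int) (v : V) : Prop := Lop 0 v = k%:~R *: v.

Definition is_VOA : Prop :=
  is_vertex_algebra /\
  (forall (a b : int) v,
        Lop a (Lop b v) - Lop b (Lop a v) =
        (a - b)%:~R *: Lop (a + b) v
        + (if a + b == 0 then ((a ^+ 3 - a)%:~R / 12%:R) * c else 0) *: v) /\
  (* Y(L(-1)w, z) = d/dz Y(w, z) *)
  (forall w n v, Y (Lop (-1) w) n v = - n%:~R *: Y w (n - 1) v) /\
  wt_space 2 om /\
  (forall v, exists s : seq (int * V),
        v = \sum_(x <- s) x.2 /\ (forall x, x \in s -> wt_space x.1 x.2)) /\
  (forall k : int, exists b : seq V, forall v, wt_space k v ->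
        exists cf : nat -> K, v = \sum_(i < size b) cf i *: nth 0 b i) /\
  (exists N : int, forall k v, k < N -> wt_space k v -> v = 0).

Variables (g : V -> V) (T : nat) (zeta : K).

Definition is_VOA_automorphism : Prop :=
  [/\ linearP g, bijective g,
      forall u n v, g (Y u n v) = Y (g u) n (g v),
      g one = one & g om = om].

Definition has_order : Prop :=
  (0 < T)%N /\ (forall v, iter T g v = v) /\
  (forall k, (0 < k < T)%N -> exists v, iter k g v <> v).

(* projection onto V^r = { v | g v = zeta^(-r) v } *)
Definition gproj (r : nat) (u : V) : V :=
  (T%:R)^-1 *: \sum_(j < T) (zeta ^+ (r * j)) *: iter j g u.

(* index bookkeeping: an element n of (1/T)N is represented by its numerator
   nn : nat, n = nn/T, floor n = nn %/ T, bar n = nn %% T *)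
Definition fl (nn : nat) : int := (nn %/ T)%:Z.
Definition fr (nn : nat) : nat := (nn %% T)%N.
Definition del (k l : nat) : int := (l <= k)%N%:Z.
Definition ratT (nn : nat) : K := nn%:R / T%:R.
Definition congr (r nn pp : nat) : bool := ((fr pp + T - fr nn) %% T == r)%N.
(* exponent of (1+y) resp. (1+z) (without wt u) *)
Definition aexp (r mm : nat) : K := -1 + (fl mm)%:~R + (del (fr mm) r)%:~R + ratT r.
(* exponent of y resp. z in the denominator, for the bullet/star product *)
Definition bexp (r mm nn pp : nat) : int :=
  fl mm + fl nn - fl pp + del (fr mm) r + del (fr nn) (T - r).

(* Res_y (1+y)^a y^(-k) Y(u, log(1+y)) v *)
Definition resY (a : K) (k : int) (u v : V) : V :=
  esum (- k) (fun n => psmul (binK a) (lampow (- n - 1)) (absz (k + n)) *: Y u n v).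

(* C(L(0) + a, j) u  (equal to binom(wt u + a, j) u for homogeneous u) *)
Fixpoint fallop (a : K) (j : nat) (u : V) : V :=
  match j with
  | 0 => u
  | j'.+1 => let x := fallop a j' u in Lop 0 x + (a - j'%:R) *: x
  end.
Definition binop (a : K) (j : nat) (u : V) : V := (j`!%:R)^-1 *: fallop a j u.

(* Res_z (1+z)^(wt u + a) z^(-k) Y(u, z) v, extended linearly in u *)
Definition resZ (a : K) (k : int) (u v : V) : V :=
  esum 0 (fun j => Y (binop a (absz j) u) (j - k) v).

Definition gprod (res : K -> int -> V -> V -> V) (nn mm pp : nat) (u v : V) : V :=
  \sum_(r < T) (if congr r nn pp then
     \sum_(i < (pp %/ T).+1)
        ((-1) ^+ i * binK (bexp r mm nn pp - 1 + i%:Z)%:~R i) *: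
          res (aexp r mm) (bexp r mm nn pp + i%:Z) (gproj r u) v
   else 0).
Definition gcirc (res : K -> int -> V -> V -> V) (nn mm : nat) (u v : V) : V :=
  \sum_(r < T) res (aexp r mm) (bexp r mm nn 0 + 1) (gproj r u) v.

Definition bul (nn mm pp : nat) := gprod resY nn mm pp.
Definition dia (nn mm : nat) := gcirc resY nn mm.
Definition Dop (u : V) : V := Y u (-2) one.
Definition star (nn mm pp : nat) := gprod resZ nn mm pp.
Definition circ (nn mm : nat) := gcirc resZ nn mm.

Definition O1gen (circp : nat -> nat -> V -> V -> V) (DD : V -> V) (nn mm : nat) : V -> Prop :=
  inspan (fun x => (exists u v, x = circp nn mm u v) \/
                   (exists u, x = DD u + (ratT mm - ratT nn) *: u)).

Definition Ogen (prod : nat -> nat -> nat -> V -> V -> V) (O1 : nat -> nat -> V -> Prop)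
    (nn mm : nat) : V -> Prop :=
  inspan (fun x =>
    O1 nn mm x
    \/ (exists (p1 p2 p3 : nat) u a b cc,
          x = prod nn mm p3 u (prod p3 mm p1 (prod p3 p1 p2 a b) cc
                               - prod p3 mm p2 a (prod p2 mm p1 b cc)))
    \/ (exists (p1 p2 : nat) a y b,
          O1 p2 p1 y /\ x = prod nn mm p1 (prod nn p1 p2 a y) b)).

Definition tO1 := O1gen dia Dop.
Definition tO := Ogen bul tO1.
Definition tOn (nn : nat) := tO1 nn nn.
Definition O1 := O1gen circ (fun u => Lop (-1) u + Lop 0 u).
Definition OO := Ogen star O1.
Definition On (nn : nat) := O1 nn nn.

End Generic.

(* Main.v *)
From Stdlib Require Import ClassicalEpsilon.
Require Import Defs.
From HB Require Import structures.
From mathcomp Require Import all_boot all_order all_algebra.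
From mathcomp Require Import boolp ring zify.
Import Order.TTheory GRing.Theory Num.Theory.
Local Open Scope ring_scope.
Set Implicit Arguments. Unset Strict Implicit. Unset Printing Implicit Defensive.

(** The star side is the bullet side for Zhu's vertex operators
    [Y[u,x] = Y(e^{x L(0)} u, e^x - 1)], because
    [(1+z)^{wt u} Y(u,z) = Y[u, log(1+z)]]. So it is enough to find a linear
    bijection [f], commuting with [g], such that
    [f (Y(u,x) v) = Y[f u, x] (f v)]; it then carries every space and product
    of one side exactly onto its analogue on the other side.

    Let [L[0] = L(0) + sum_(j >= 1) (-1)^(j-1) / (j (j+1)) L(j)], the residue
    of [(1+y) log(1+y) Y(omega,y)]. As [L[0] - L(0)] lowers weights, there is
    a unique [f = id + (weight-lowering)] with [f L(0) = L[0] f]. Now [L(0)]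
    is an Euler operator for [Y] and [L[0]] is one for [Y[.,x]], so the
    [y]-coefficients [D_k] of the difference
    [f Y(u, log(1+y)) v - Y((1+y)^{L(0)} f u, y) f v] satisfy a triangular
    recursion in [k]. Inductively, [D_k] is an [L[0]]-eigenvector whose
    eigenvalue exceeds all weights occurring in it, hence [D_k = 0]. *)

(** * Formal power series *)

(** A named copy of the function type, so that the ring structure with product [psmul] can be
    attached to it and [ring] applies to identities of series. *)
Definition fps (K : fieldType) : Type := nat -> K.
HB.instance Definition _ (K : fieldType) := gen_eqMixin (fps K).
HB.instance Definition _ (K : fieldType) := gen_choiceMixin (fps K).

Section FpsRing.
Variable K : fieldType.
Implicit Types f h : fps K.

Definition fps_add f h : fps K := fun i => f i + h i.
Definition fps_opp f : fps K := fun i => - f i.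
Definition fps_const (a : K) : fps K := fun i => if i == 0%N then a else 0.

(** Coefficient [k] of a product sees only the truncations of the factors, so the ring laws can be
    read off from polynomials. *)
Lemma psmul_poly_le f h n k : (k < n)%N ->
  psmul f h k = ((\poly_(i < n) f i) * (\poly_(i < n) h i))`_k.
Proof.
move=> kn; rewrite coefM; apply: eq_bigr => i _.
have ik : (i <= k)%N by rewrite -ltnS.
by rewrite !coef_poly (leq_ltn_trans ik kn) (leq_ltn_trans (leq_subr _ _) kn).
Qed.

Lemma psmul_poly f h k :
  psmul f h k = ((\poly_(i < k.+1) f i) * (\poly_(i < k.+1) h i))`_k.
Proof. exact: psmul_poly_le. Qed.

Let addA : associative fps_add.
Proof. by move=> f h l; apply/funext => i; rewrite /fps_add addrA. Qed.
Let addC : commutative fps_add.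
Proof. by move=> f h; apply/funext => i; rewrite /fps_add addrC. Qed.
Let add0 : left_id (fun _ => 0) fps_add.
Proof. by move=> f; apply/funext => i; rewrite /fps_add add0r. Qed.
Let addN : left_inverse (fun _ => 0) fps_opp fps_add.
Proof. by move=> f; apply/funext => i; rewrite /fps_add addNr. Qed.

HB.instance Definition _ := GRing.isZmodule.Build (fps K) addA addC add0 addN.

Let mulC : commutative (@psmul K : fps K -> fps K -> fps K).
Proof. by move=> f h; apply/funext => i; rewrite !psmul_poly mulrC. Qed.

Let mulA : associative (@psmul K : fps K -> fps K -> fps K).
Proof.
move=> f h l; apply/funext => k.
rewrite !psmul_poly !(mulrC (\poly_(i < k.+1) f i)).
set F := \poly_(i < k.+1) f i; set H := \poly_(i < k.+1) h i.
set L := \poly_(i < k.+1) l i.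
(* A truncated factor may be exchanged for any polynomial with the same coefficients up to degree
   [k]. *)
have E p (q P : {poly K}) : (forall i, (i < k.+1)%N -> p i = q`_i) ->
    ((\poly_(i < k.+1) p i) * P)`_k = (q * P)`_k.
  move=> pq; rewrite !coefM; apply: eq_bigr => i _.
  by rewrite coef_poly ltn_ord pq.
have -> := E (psmul h l) (H * L) F (fun i => @psmul_poly_le h l k.+1 i).
have -> := E (psmul f h) (F * H) L (fun i => @psmul_poly_le f h k.+1 i).
by rewrite mulrC mulrA.
Qed.
Let mul1 : left_id (@ps1 K : fps K) (@psmul K : fps K -> fps K -> fps K).
Proof.
move=> f; apply/funext => k; rewrite /psmul big_ord_recl /= mul1r subn0.
by rewrite big1 ?addr0 // => i _; rewrite /ps1 /= mul0r.
Qed.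
Let mulD : left_distributive (@psmul K : fps K -> fps K -> fps K) fps_add.
Proof.
move=> f h l; apply/funext => k; rewrite /psmul /fps_add -big_split /=.
by apply: eq_bigr => i _; rewrite mulrDl.
Qed.

HB.instance Definition _ :=
  GRing.Zmodule_isComPzRing.Build (fps K) mulA mulC mul1 mulD.

Lemma fps_addE f h i : (f + h) i = f i + h i. Proof. by []. Qed.
Lemma fps_oppE f i : (- f) i = - f i. Proof. by []. Qed.
Lemma fps_mulE f h i : (f * h) i = \sum_(j < i.+1) f j * h (i - j)%N.
Proof. by []. Qed.
Lemma fps_constM a f i : (fps_const a * f) i = a * f i.
Proof.
rewrite fps_mulE big_ord_recl /= subn0 big1 ?addr0 // => j _.
by rewrite /fps_const /= mul0r.
Qed.
Lemma fps_constD a b : fps_const (a + b) = fps_const a + fps_const b.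
Proof. by apply/funext => -[|i]; rewrite fps_addE /fps_const //= addr0. Qed.
Lemma fps_constN a : fps_const (- a) = - fps_const a.
Proof. by apply/funext => -[|i]; rewrite fps_oppE /fps_const //= oppr0. Qed.
Lemma fps_const1 : fps_const 1 = 1.
Proof. by apply/funext. Qed.

Lemma fps_eval f h i : f = h -> f i = h i. Proof. by move->. Qed.
Lemma fps_one0 : (1 : fps K) 0%N = 1. Proof. by []. Qed.
Lemma fps_oneS i : (1 : fps K) i.+1 = 0. Proof. by []. Qed.

Definition fpsX : fps K := fun i => if i == 1%N then 1 else 0.
Lemma fpsXM0 f : (fpsX * f) 0%N = 0.
Proof. by rewrite fps_mulE big_ord1 mul0r. Qed.
Lemma fpsXMS f i : (fpsX * f) i.+1 = f i.
Proof.
rewrite fps_mulE !big_ord_recl /= mul0r add0r mul1r subSS subn0.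
by rewrite big1 ?addr0 // => j _; rewrite /fpsX /= mul0r.
Qed.

Definition fpsD f : fps K := fun i => i.+1%:R * f i.+1.
Lemma fpsXD f i : (fpsX * fpsD f) i = i%:R * f i.
Proof. by case: i => [|i]; rewrite ?fpsXM0 ?mul0r ?fpsXMS. Qed.
Lemma fpsD_add f h : fpsD (f + h) = fpsD f + fpsD h.
Proof. by apply/funext => i; rewrite fps_addE /fpsD fps_addE mulrDr. Qed.
Lemma fpsX_inj f h : fpsX * f = fpsX * h -> f = h.
Proof.
move=> E; apply/funext => i.
by have := congr1 (fun l : fps K => l i.+1) E; rewrite /= !fpsXMS.
Qed.
(** After multiplication by [fpsX] the derivative becomes the Euler operator, which scales
    coefficient [i] by [i]; the rule is then [i = j + (i - j)]. *)
Lemma fpsDM f h : fpsD (f * h) = fpsD f * h + f * fpsD h.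
Proof.
apply: fpsX_inj; apply/funext => i.
rewrite mulrDr mulrA (mulrCA fpsX f) fps_addE fpsXD !fps_mulE mulr_sumr.
rewrite -big_split; apply: eq_bigr => j _ /=.
have ji : (j <= i)%N by rewrite -ltnS.
rewrite !fpsXD natrB //; ring.
Qed.
Lemma fpsD_const a : fpsD (fps_const a) = 0.
Proof. by apply/funext => i; rewrite /fpsD /= mulr0. Qed.
Lemma fpsDX : fpsD fpsX = 1.
Proof. by apply/funext => -[|i]; rewrite /fpsD /fpsX /= ?mulr0 ?mulr1. Qed.
Lemma fpsD1 : fpsD 1 = 0.
Proof. by rewrite -fps_const1 fpsD_const. Qed.

Lemma size_inv_list f k : size (inv_list f k) = k.
Proof. by elim: k => //= k IH; rewrite size_rcons IH. Qed.
Lemma nth_inv_list f k i : (i < k)%N -> nth 0 (inv_list f k) i = psinv f i.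
Proof.
elim: k => // k IH; rewrite ltnS leq_eqVlt => /orP[/eqP->//|ik].
by rewrite /= nth_rcons size_inv_list ik IH.
Qed.
Lemma psinvE f k : psinv f k =
  if k == 0%N then 1 else - \sum_(j < k) f j.+1 * psinv f (k - j.+1)%N.
Proof.
rewrite {1}/psinv /= nth_rcons size_inv_list ltnn eqxx.
case: ifP => // /negbT k0; congr (- _); apply: eq_bigr => j _.
rewrite nth_inv_list //; have := ltn_ord j; lia.
Qed.
(** The recursion [psinvE] says exactly that the higher coefficients of the product vanish. *)
Lemma mul_psinv f : f 0%N = 1 -> f * (psinv f : fps K) = 1.
Proof.
move=> f0; apply/funext => k; rewrite fps_mulE big_ord_recl f0 mul1r subn0.
rewrite psinvE; case: k => [|k] /=; first by rewrite big_ord0 addr0.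
by rewrite addNr.
Qed.

End FpsRing.
Arguments fpsX {K}.

(** * Binomial series and integral powers of [log(1+y)/y] *)

Section Series.
Variable K : numFieldType.
Local Notation F := (fps K).

Lemma binKS (a : K) j : j.+1%:R * binK a j.+1 = (a - j%:R) * binK a j.
Proof.
rewrite /binK big_ord_recr /= factS natrM; field.
by rewrite nat1r !pnatr_eq0 -lt0n fact_gt0.
Qed.
Lemma binK0 (a : K) : binK a 0 = 1.
Proof. by rewrite /binK big_ord0 fact0 divr1. Qed.
Lemma binK0S j : binK (0 : K) j.+1 = 0.
Proof. by rewrite /binK big_ord_recl subr0 !mul0r. Qed.
Lemma binK_nat n i : binK (n%:R : K) i = ('C(n, i))%:R.
Proof.
have H j : (j.+1%:R : K) != 0 by rewrite pnatr_eq0.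
elim: i => [|i IH]; first by rewrite binK0 bin0.
apply: (mulfI (H i)); rewrite binKS IH -!natrM mul_bin_left.
case: (leqP i n) => [le|lt]; first by rewrite -natrB // natrM.
by rewrite bin_small // muln0 mulr0.
Qed.

Definition pow1p (a : K) : F := binK a.

Lemma pow1p_deriv a : (1 + fpsX) * fpsD (pow1p a) = fps_const a * pow1p a.
Proof.
apply/funext => s; rewrite mulrDl mul1r fps_addE fpsXD fps_constM /fpsD /pow1p binKS.
ring.
Qed.
Lemma pow1pS a : pow1p (a + 1) = (1 + fpsX) * pow1p a.
Proof.
apply/funext => -[|s]; rewrite mulrDl mul1r fps_addE ?fpsXM0 ?fpsXMS /pow1p.
  by rewrite !binK0 addr0.
have H : (s.+1%:R : K) != 0 by rewrite pnatr_eq0.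
apply: (mulfI H); rewrite mulrDr (binKS a).
rewrite /binK big_ord_recl factS natrM.
have -> : \prod_(i < s) (a + 1 - (lift ord0 i)%:R) = \prod_(i < s) (a - i%:R).
  by apply: eq_bigr => i _; rewrite lift0 -natr1; ring.
rewrite subr0; field.
by rewrite nat1r !pnatr_eq0 -lt0n fact_gt0.
Qed.
Lemma pow1p0 : pow1p 0 = 1.
Proof. by apply/funext => -[|i]; rewrite /pow1p ?binK0 ?binK0S. Qed.
Lemma pow1p_pred a : pow1p (a - 1) = pow1p (-1) * pow1p a.
Proof.
have E : (1 + fpsX) * pow1p (-1) = 1 by rewrite -pow1pS addNr pow1p0.
by rewrite -{2}(subrK 1 a) pow1pS mulrA (mulrC (pow1p (-1))) E mul1r.
Qed.
(** Induction on [n], splitting off one factor [(1+y)^(-1)] at a time. It matches the weight drop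
    caused by [L(j)] with a change of exponent. *)
Lemma pow1pMNn a n : pow1p a * pow1p (- n%:R) = pow1p (a - n%:R).
Proof.
elim: n a => [|n IH] a; first by rewrite oppr0 pow1p0 mulr1 addr0.
rewrite -natr1 !opprD addrA 2!pow1p_pred mulrCA IH; ring.
Qed.

Definition lamF : F := @lam K.

(** The derivative [1/(1+y)] of [log(1+y) = y lam], cleared of its denominator. *)
Lemma lam_deriv : fpsX * ((1 + fpsX) * fpsD lamF) = 1 - (1 + fpsX) * lamF.
Proof.
have H (j : nat) : (j.+1%:R : K) != 0 by rewrite pnatr_eq0.
apply/funext => -[|[|s]]; rewrite ?fpsXM0 ?fpsXMS fps_addE fps_oppE !mulrDl !mul1r
  !fps_addE ?fpsXM0 ?fpsXMS /lamF /lam /fpsD ?fps_one0 ?fps_oneS.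
- by rewrite expr0 divr1 addr0 subrr.
- by field.
- rewrite !exprS; field.
  by rewrite -!natrD !pnatr_eq0.
Qed.

Lemma mul_psinv_lam : lamF * (psinv lamF : F) = 1.
Proof. by apply: mul_psinv; rewrite /lamF /lam expr0 divr1. Qed.
Lemma lamF_inj : injective ( *%R lamF).
Proof.
move=> f h /(congr1 ( *%R (psinv lamF : F))).
by rewrite !mulrA (mulrC (psinv lamF : F)) mul_psinv_lam !mul1r.
Qed.

Definition lamF_pow (m : int) : F := lampow K m.

Lemma lamF_powS m : lamF_pow (m + 1) = lamF * lamF_pow m.
Proof.
rewrite /lamF_pow.
case: m => [m|[|m]].
- by rewrite (_ : Posz m + 1 = m.+1%:Z) //= addrC.
- rewrite (_ : Negz 0 + 1 = 0) //=.
  by rewrite [psmul _ _](mulr1 (psinv lamF : F)) mul_psinv_lam.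
- rewrite (_ : Negz m.+1 + 1 = Negz m) /=; last by rewrite !NegzE; lia.
  set Q := psmul _ (iter m _ _).
  rewrite [psmul _ Q](_ : _ = (psinv lamF : F) * (Q : F)) // mulrA mul_psinv_lam.
  by rewrite mul1r.
Qed.

Lemma lamF_pow_coef0 m : lamF_pow m 0%N = 1.
Proof.
have step j : lamF_pow (j + 1) 0%N = lamF_pow j 0%N.
  by rewrite lamF_powS fps_mulE big_ord1 /lamF /lam expr0 divr1 mul1r.
elim/int_rec: m => [//|m IH|m IH].
  by have E : m.+1%:Z = m%:Z + 1; [lia | rewrite E step].
by have E : - m.+1%:Z + 1 = - m%:Z; [lia | rewrite -step E].
Qed.

(** Chain rule: [lam_deriv] multiplied by [m lam^(m-1)], proved by stepping the exponent up and
    down. *)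
Lemma lamF_pow_deriv m :
  fpsX * ((1 + fpsX) * fpsD (lamF_pow m)) =
  fps_const m%:~R * (lamF_pow (m - 1) - (1 + fpsX) * lamF_pow m).
Proof.
have step j : fpsX * ((1 + fpsX) * fpsD (lamF_pow (j + 1))) =
    lamF_pow j - (1 + fpsX) * lamF_pow (j + 1)
      + lamF * (fpsX * ((1 + fpsX) * fpsD (lamF_pow j))).
  rewrite lamF_powS fpsDM.
  transitivity (fpsX * ((1 + fpsX) * fpsD lamF) * lamF_pow j +
    lamF * (fpsX * ((1 + fpsX) * fpsD (lamF_pow j)))); first ring.
  rewrite lam_deriv; ring.
have lp j : lamF_pow j = lamF * lamF_pow (j - 1).
  by rewrite -lamF_powS subrK.
elim/int_rec: m => [|m IH|m IH].
- rewrite (_ : lamF_pow 0 = 1) // fpsD1 !mulr0.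
  by rewrite (_ : fps_const _ = 0) ?mul0r //; apply/funext => -[].
- have -> : m.+1%:Z = m%:Z + 1 by lia.
  rewrite step IH addrK intrD mulr1z fps_constD fps_const1 lamF_powS (lp m%:Z); ring.
(* For negative exponents [step] is read backwards, and the invertible factor [lamF] is
   cancelled. *)
- apply: lamF_inj; have := step (- m.+1%:Z).
  have -> : - m.+1%:Z + 1 = - m%:Z by lia.
  rewrite IH; have -> : - m%:Z - 1 = - m.+1%:Z by lia.
  move/esym/(canRL (addKr _)) => ->.
  have comm (x y z w : F) : lamF * (x * (y - z * w)) = x * (lamF * y - z * (lamF * w)).
    ring.
  rewrite comm -lp -lamF_powS.
  have -> : - m.+1%:Z + 1 = - m%:Z by lia.
  have -> : (- m.+1%:Z)%:~R = (- m%:Z)%:~R - 1 :> K by rewrite -addn1 PoszD opprD rmorphD.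
  rewrite fps_constD fps_constN fps_const1; ring.
Qed.

(* [(1+y) log(1+y)] *)
Definition log1pM : F := fpsX * ((1 + fpsX) * lamF).

Lemma log1pM0 : log1pM 0%N = 0. Proof. exact: fpsXM0. Qed.
Lemma log1pM1 : log1pM 1%N = 1.
Proof.
rewrite /log1pM fpsXMS mulrDl mul1r fps_addE fpsXM0 addr0.
by rewrite /lamF /lam expr0 divr1.
Qed.
Lemma log1pMSS e : log1pM e.+2 = (-1) ^+ e / (e.+1%:R * e.+2%:R).
Proof.
rewrite /log1pM fpsXMS mulrDl mul1r fps_addE fpsXMS /lamF /lam exprS; field.
by rewrite ?nat1r -?natrD !pnatr_eq0.
Qed.
Lemma log1pM_deriv : fpsD log1pM = 1 + fpsX * lamF.
Proof.
rewrite /log1pM fpsDM fpsDX mul1r fpsDM fpsD_add fpsD1 fpsDX add0r.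
rewrite mul1r !mulrDr lam_deriv; ring.
Qed.

(* For [l = (1+y) log(1+y)] and [i >= 2], the divided derivative [l^(i) / i!]
   is [l_i (1+y)^(1-i)]. *)
Lemma log1pM_divided p q :
  log1pM (p.+2 + q)%N * ('C(p.+2 + q, p.+2))%:R = log1pM p.+2 * pow1p (- p.+1%:R) q.
Proof.
elim: q => [|q IH]; first by rewrite addn0 binn mulr1 /pow1p binK0 mulr1.
have H : (q.+1%:R : K) != 0 by rewrite pnatr_eq0.
apply: (mulfI H); rewrite [RHS]mulrCA /pow1p binKS [RHS]mulrCA -/(pow1p _ q) -IH [LHS]mulrCA.
have -> : q.+1%:R * ('C(p.+2 + q.+1, p.+2))%:R = (p.+2 + q).+1%:R * ('C(p.+2 + q, p.+2))%:R :> K.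
  rewrite -!natrM; congr (_%:R); rewrite addnS.
  by have := mul_bin_down (p.+2 + q).+1 p.+2; rewrite subSn ?leq_addr // addKn => <-.
rewrite addnS !addSn !log1pMSS exprS; field.
by rewrite -natrD ?nat1r -?natrD !pnatr_eq0.
Qed.

(* Coefficient [s] of [y d/dy] applied to [(1+y)^(a+1) lam^m]. *)
Lemma lamF_pow_euler (a : K) (k : int) (s : nat) (m := k - s%:Z) :
  m%:~R * (pow1p a * lamF_pow (m - 1)) s =
  (lamF * (fps_const k%:~R + fps_const (k%:~R - a - 1) * fpsX) * (pow1p a * lamF_pow (m - 1))) s.
Proof.
have E := fpsXD ((1 + fpsX) * pow1p a * lamF_pow m) s.
(* The exponent [m] varies with [s] so that [k = m + s]; the factor [s] produced by the Euler
   operator can then be traded for [k - m]. *)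
have kE : k%:~R = m%:~R + s%:R :> K by rewrite /m rmorphB /= subrK.
have lp : lamF_pow m = lamF * lamF_pow (m - 1) by rewrite -lamF_powS subrK.
have {}E : s%:R * ((1 + fpsX) * pow1p a * lamF_pow m) s =
   (fps_const (a + 1) * fpsX * pow1p a * lamF_pow m + fps_const m%:~R * (pow1p a * lamF_pow (m - 1))
     - fps_const m%:~R * ((1 + fpsX) * pow1p a * lamF_pow m)) s.
  rewrite -E -pow1pS -mulrA -!mulrA.
  apply: fps_eval; rewrite fpsDM.
  have -> : fpsX * (fpsD (pow1p (a + 1)) * lamF_pow m + pow1p (a + 1) * fpsD (lamF_pow m)) =
    fpsX * fpsD (pow1p (a + 1)) * lamF_pow m + pow1p a * (fpsX * ((1 + fpsX) * fpsD (lamF_pow m))).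
    rewrite pow1pS; ring.
  have -> : fpsD (pow1p (a + 1)) = fps_const (a + 1) * pow1p a.
    rewrite pow1pS fpsDM fpsD_add fpsD1 fpsDX add0r mul1r pow1p_deriv fps_constD fps_const1; ring.
  rewrite lamF_pow_deriv pow1pS; ring.
rewrite -fps_constM.
have -> : fps_const m%:~R * (pow1p a * lamF_pow (m - 1)) =
  fps_const m%:~R * ((1 + fpsX) * pow1p a * lamF_pow m) - fps_const (a + 1) * fpsX * pow1p a * lamF_pow m
  + (fps_const (a + 1) * fpsX * pow1p a * lamF_pow m + fps_const m%:~R * (pow1p a * lamF_pow (m - 1))
     - fps_const m%:~R * ((1 + fpsX) * pow1p a * lamF_pow m)) by ring.
rewrite fps_addE -E -fps_constM -fps_addE; apply: fps_eval.
rewrite kE lp !fps_constD !fps_constN fps_const1; ring.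
Qed.

(** On the left are the contributions of [L(-1) u] and [L(0) u] to the commutator of [L[0]] with a
    residue, less the [L(0)] part of [L[0] u]; what remains is the derivative term integrated by
    parts. *)
Lemma pow1p_log1p_coef (a h : K) (k : int) (s : nat) (cc := pow1p (a + h)) :
  (k%:~R - s.+1%:R) * (cc * log1pM) s.+1 + h * (cc * fpsD log1pM - cc) s =
  - cc s + (lamF * (fps_const k%:~R + fps_const (k%:~R - a - 1) * fpsX) * cc) s.
Proof.
have E1 : (cc * log1pM) s.+1 = (cc * (1 + fpsX) * lamF) s.
  by rewrite /log1pM mulrCA fpsXMS mulrA.
have E2 : s.+1%:R * (cc * log1pM) s.+1 = (fps_const (a + h) * cc * fpsX * lamF + cc * (1 + fpsX * lamF)) s.
  rewrite -[LHS]/(fpsD (cc * log1pM) s) fpsDM log1pM_deriv; apply: fps_eval.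
  rewrite /log1pM; transitivity ((1 + fpsX) * fpsD cc * (fpsX * lamF) + cc * (1 + fpsX * lamF)); first ring.
  rewrite /cc pow1p_deriv; ring.
rewrite mulrBl E2 E1 -!fps_constM -!fps_oppE -!fps_addE -(fps_addE (- cc)); apply: fps_eval.
rewrite log1pM_deriv !fps_constD !fps_constN fps_const1; ring.
Qed.

End Series.

(** * Eventually vanishing sums *)

Section FiniteSums.
Variables (K : fieldType) (V : lmodType K).

Lemma sum_truncate (F : nat -> V) M J :
  (forall i, (M <= i)%N -> F i = 0) -> (M <= J)%N ->
  \sum_(i < J) F i = \sum_(i < M) F i.
Proof.
move=> F0 MJ; rewrite -!(big_mkord xpredT F) (big_cat_nat (n := M)) //=.
rewrite [X in _ + X]big_nat_cond [X in _ + X]big1 ?addr0 //.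
by move=> i /andP[/andP[/F0]].
Qed.

(** The chosen truncation point and [M] both bound the support, so the larger of them only adds zero
    terms. *)
Lemma esumE (lo : int) (F : int -> V) M :
  (forall i : nat, (M <= i)%N -> F (lo + i%:Z) = 0) ->
  esum lo F = \sum_(i < M) F (lo + i%:Z).
Proof.
move=> F0; rewrite /esum; case: excluded_middle_informative => [H|[]]; last by exists M.
case: ClassicalEpsilon.constructive_indefinite_description => N FN /=.
by case: (leqP M N) => [|/ltnW] le; [|symmetry]; apply: (sum_truncate (F := fun i => F (lo + i%:Z))).
Qed.

(** Regrouping by total degree [s = j + i] turns two successive expansions into the coefficients of
    one product of series. *)
Lemma sum_triangle (G : nat -> nat -> V) M J :
  (forall j i, (M <= j + i)%N -> G j i = 0) -> (M <= J)%N ->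
  \sum_(j < J) \sum_(i < M) G j i = \sum_(s < M) \sum_(j < s.+1) G j (s - j)%N.
Proof.
move=> G0 MJ.
have E (s : 'I_M) : \sum_(j < s.+1) G j (s - j)%N = \sum_(j < J | (j <= s)%N) G j (s - j)%N.
  by rewrite (big_ord_widen J (fun j => G j (s - j)%N)) ?(leq_trans _ MJ).
rewrite [RHS](eq_bigr _ (fun s _ => E s)) [RHS](exchange_big_dep xpredT) //=.
apply: eq_bigr => j _.
transitivity (\sum_(0 <= s < M | (j <= s)%N) G j (s - j)%N); last by rewrite big_mkord.
case: (leqP j M) => [jM|/ltnW Mj]; last first.
  rewrite big1 => [|i _]; last by rewrite G0 // (leq_trans Mj) ?leq_addr.
  rewrite big_nat_cond big1 // => i /andP[/andP[_ iM] ji].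
  by have := leq_trans (leq_trans iM Mj) ji; rewrite ltnn.
rewrite (big_cat_nat (n := j)) //=.
have -> : \sum_(0 <= s < j | (j <= s)%N) G j (s - j)%N = 0.
  rewrite big_nat_cond big1 // => i /andP[/andP[_ ij] ji].
  by have := leq_trans ij ji; rewrite ltnn.
rewrite add0r.
have -> : \sum_(j <= s < M | (j <= s)%N) G j (s - j)%N = \sum_(i < M - j) G j i.
  rewrite -[X in \sum_(X <= _ < _ | _) _]add0n big_addn big_mkord.
  by apply: eq_big => [i|i _]; rewrite ?leq_addl ?addnK.
apply: sum_truncate; last exact: leq_subr.
by move=> i le; apply: G0; lia.
Qed.

(** Only finitely many modes [om_e], [e >= 0], are nonzero on a given vector; this yields one
    truncation bound for all of them. *)
Lemma uniform_bound (P : nat -> nat -> Prop) n :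
  (forall p, exists M, forall i, (M <= i)%N -> P p i) ->
  exists M, forall p i, (p < n)%N -> (M <= i)%N -> P p i.
Proof.
move=> H; elim: n => [|n [M IH]]; first by exists 0%N.
have [N HN] := H n; exists (maxn M N) => p i; rewrite geq_max ltnS leq_eqVlt.
by case/orP => [/eqP->|pn] /andP[Mi Ni]; [apply: HN | apply: IH].
Qed.

Variables (f : V -> V) (lf : Defs.linearP f).
Lemma linP0 : f 0 = 0.
Proof. by have := lf (-1) 0 0; rewrite scaler0 addr0 scaleN1r addNr. Qed.
Lemma linPD x y : f (x + y) = f x + f y.
Proof. by have := lf 1 x y; rewrite !scale1r. Qed.
Lemma linPZ a x : f (a *: x) = a *: f x.
Proof. by have := lf a x 0; rewrite linP0 !addr0. Qed.
Lemma linPN x : f (- x) = - f x.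
Proof. by rewrite -scaleN1r linPZ scaleN1r. Qed.
Lemma linP_sum (I : Type) (r : seq I) (P : pred I) F :
  f (\sum_(i <- r | P i) F i) = \sum_(i <- r | P i) f (F i).
Proof. exact: (big_morph f linPD linP0). Qed.
End FiniteSums.

Lemma esum_linear (K : fieldType) (V : lmodType K) (lo : int) (F : int -> V -> V) :
  (forall n, Defs.linearP (F n)) ->
  (forall v, exists M : nat, forall i : nat, (M <= i)%N -> F (lo + i%:Z) v = 0) ->
  Defs.linearP (fun v => esum lo (F^~ v)).
Proof.
move=> lF tF a x y.
have [M HM] := tF x; have [N HN] := tF y.
pose J := maxn M N.
have Hx i : (J <= i)%N -> F (lo + i%:Z) x = 0.
  by rewrite geq_max => /andP[/HM].
have Hy i : (J <= i)%N -> F (lo + i%:Z) y = 0.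
  by rewrite geq_max => /andP[_ /HN].
rewrite (esumE Hx) (esumE Hy) (@esumE _ _ _ _ J) => [|i le]; last first.
  by rewrite lF Hx // Hy // scaler0 addr0.
by rewrite scaler_sumr -big_split; apply: eq_bigr => i _; rewrite lF.
Qed.

(** * Modes and residues *)

Section VertexOperators.
Variables (K : numFieldType) (V : lmodType K).
Variables (Y : V -> int -> V -> V) (one om : V) (c : K).
Hypothesis voa : is_VOA Y one om c.
Local Notation hom := (wt_space Y om).

Lemma Y_linl n v : Defs.linearP (fun u => Y u n v).
Proof. by case: voa => -[H _] _ a u u'; apply: H. Qed.
Lemma Y_linr u n : Defs.linearP (Y u n).
Proof. by case: voa => -[_ [H _]] _ a v v'; apply: H. Qed.

Lemma Y_trunc u v (k : int) : exists M : nat, forall i : nat, (M <= i)%N -> Y u (i%:Z - k) v = 0.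
Proof.
case: voa => -[_ [_ [H _]]] _; have [N HN] := H u v.
by exists (absz (N + k)) => i le; apply: HN; lia.
Qed.
Lemma om_trunc v : exists M : nat, forall i : nat, (M <= i)%N -> Y om i%:Z v = 0.
Proof. by have [M HM] := Y_trunc om v 0; exists M => i /HM; rewrite subr0. Qed.

Lemma Y_one u : Y u (-1) one = u.
Proof. by case: voa => -[_ [_ [_ [_ [H _]]]]] _; case: (H u). Qed.
Lemma Y_one_ge0 u n : 0 <= n -> Y u n one = 0.
Proof. by case: voa => -[_ [_ [_ [_ [H _]]]]] _; case: (H u) => _; apply. Qed.

Lemma Y_om0 w n v : Y (Y om 0 w) n v = - n%:~R *: Y w (n - 1) v.
Proof. by case: voa => _ [_ [H _]]; apply: H. Qed.

Lemma homE h v : hom h v <-> Y om 1 v = h%:~R *: v.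
Proof. by []. Qed.

(** The Borcherds identity with [p = e], [q = n], [r = 0]: only [i = 0] survives on its right side,
    and [C(e, i) = 0] for [i > e] cuts off its left side. *)
Lemma om_comm e u n w M : (e < M)%N ->
  Y om e%:Z (Y u n w) = Y u n (Y om e%:Z w) +
  \sum_(i < M) ('C(e, i))%:R *: Y (Y om i%:Z u) (n + e%:Z - i%:Z) w.
Proof.
move=> eM; case: voa => -[_ [_ [_ [_ [_ H]]]]] _.
have [N HN] := H om u w e%:Z n 0.
have NJ : (N <= (maxn N M).+1)%N by rewrite (leq_trans (leq_maxl N M)).
have E := HN _ NJ; rewrite [RHS]big_ord_recl [X in _ = _ + X]big1 in E; last first.
  by move=> i _; rewrite lift0 binK0S mulr0 scale0r.
have Z0 : Posz (@ord0 (maxn N M)) = 0 by [].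
rewrite expr0 binK0 mulr1 scale1r expr0z scale1r Z0 !addr0 in E.
rewrite addrC; apply/eqP; rewrite -subr_eq -E; apply/eqP.
rewrite (@sum_truncate _ _ (fun i => binK e%:~R i *: Y (Y om (0 + i%:Z) u) (e%:Z + n - i%:Z) w) M).
- by apply: eq_bigr => i _; rewrite (binK_nat K e) add0r (addrC e%:Z).
- move=> i le; rewrite (binK_nat K e) bin_small ?scale0r //; exact: leq_trans eM le.
- by rewrite (leq_trans (leq_maxr N M)).
Qed.

(** [[L(0), u_n] = (L(0)u)_n + (L(-1)u)_(n+1)], and the last term is [-(n+1) u_n]. *)
Lemma hom_Y h h' u v n : hom h u -> hom h' v -> hom (h + h' - n - 1) (Y u n v).
Proof.
move=> /homE hu /homE hv; apply/homE.
have S2 (F : nat -> V) : \sum_(i < 2) F i = F 0%N + F 1%N.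
  by rewrite !big_ord_recl big_ord0 addr0.
rewrite (@om_comm 1 _ _ _ 2) // (S2 (fun i => ('C(1, i))%:R *: Y (Y om i%:Z u) (n + 1%:Z - i%:Z) v)).
rewrite bin0 binn !scale1r subr0 addrK.
rewrite hv hu Y_om0 (linPZ (Y_linr u n)) (linPZ (Y_linl _ v)) addrK.
rewrite -!scalerDl; congr (_ *: _); rewrite -!rmorphN -!rmorphD /=; congr (_%:~R); lia.
Qed.

Lemma hom_scale h a u : hom h u -> hom h (a *: u).
Proof. by move=> /homE hu; apply/homE; rewrite (linPZ (Y_linr _ _)) hu scalerA mulrC -scalerA. Qed.

Lemma hom_om h u e : hom h u -> hom (h - e + 1) (Y om e u).
Proof.
have h2 : hom 2 om by case: voa => _ [_ [_ [H _]]].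
by move=> hu; have := hom_Y e h2 hu; congr (hom _ _); lia.
Qed.

Lemma hom_ind (P : V -> Prop) :
  P 0 -> (forall h u, hom h u -> P u) -> (forall x y, P x -> P y -> P (x + y)) ->
  forall v, P v.
Proof.
move=> P0 Ph PD v; case: voa => _ [_ [_ [_ [H _]]]].
have [s [-> Hs]] := H v; elim: s Hs => [|x s IH] Hs; first by rewrite big_nil.
rewrite big_cons; apply: PD; first by apply: (Ph x.1); apply: Hs; rewrite inE eqxx.
by apply: IH => y ys; apply: Hs; rewrite inE ys orbT.
Qed.

Lemma hom_bounded : exists N : int, forall h v, h < N -> hom h v -> v = 0.
Proof. by case: voa => _ [_ [_ [_ [_ [_ H]]]]]. Qed.

Lemma binop_lin a j : Defs.linearP (binop Y om a j).
Proof.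
have fl : Defs.linearP (fallop Y om a j).
  elim: j => [|j IH] b x y //=; rewrite IH /Lop Y_linr !scalerDr !scalerA (mulrC _ b).
  by rewrite addrACA.
by move=> b x y; rewrite /binop fl scalerDr !scalerA mulrC.
Qed.
Lemma binop_hom a j h u : hom h u -> binop Y om a j u = binK (a + h%:~R) j *: u.
Proof.
move=> hu; rewrite /binop /binK.
suff -> : fallop Y om a j u = (\prod_(i < j) (a + h%:~R - i%:R)) *: u by rewrite scalerA mulrC.
elim: j => [|j IH] /=; first by rewrite big_ord0 scale1r.
rewrite IH; have /homE := hom_scale (\prod_(i < j) (a + h%:~R - i%:R)) hu.
rewrite /Lop /= => ->; rewrite -scalerDl scalerA big_ord_recr /=; congr (_ *: _); ring.
Qed.

(** The vector [binop a i u] changes with [i], so truncation for a single vector does not apply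
    directly; on a homogeneous [u] it is a multiple of [u]. *)
Lemma resZ_trunc a k u v :
  exists M : nat, forall i : nat, (M <= i)%N -> Y (binop Y om a i u) (i%:Z - k) v = 0.
Proof.
elim/hom_ind: u => [|h u hu|x y [M HM] [N HN]].
- by exists 0%N => i _; rewrite (linP0 (binop_lin _ _)) (linP0 (Y_linl _ _)).
- have [M HM] := Y_trunc u v k; exists M => i le.
  by rewrite (binop_hom _ _ hu) (linPZ (Y_linl _ _)) HM // scaler0.
- exists (maxn M N) => i; rewrite geq_max => /andP[Mi Ni].
  by rewrite (linPD (binop_lin _ _)) (linPD (Y_linl _ _)) HM // HN // addr0.
Qed.

Lemma resZE a k u v M :
  (forall i : nat, (M <= i)%N -> Y (binop Y om a i u) (i%:Z - k) v = 0) ->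
  resZ Y om a k u v = \sum_(i < M) Y (binop Y om a i u) (i%:Z - k) v.
Proof.
move=> HM; rewrite /resZ (@esumE _ _ _ _ M) => [|i le].
  by apply: eq_bigr => i _; rewrite add0r.
by rewrite add0r HM.
Qed.

Lemma resZ_hom a k h u v M : hom h u ->
  (forall i : nat, (M <= i)%N -> Y u (i%:Z - k) v = 0) ->
  resZ Y om a k u v = \sum_(i < M) pow1p (a + h%:~R) i *: Y u (i%:Z - k) v.
Proof.
move=> hu HM; have E i : Y (binop Y om a i u) (i%:Z - k) v = pow1p (a + h%:~R) i *: Y u (i%:Z - k) v.
  by rewrite (binop_hom _ _ hu) (linPZ (Y_linl _ _)).
rewrite (@resZE _ _ _ _ M) => [|i le]; last by rewrite E HM // scaler0.
by apply: eq_bigr.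
Qed.

Lemma resZ_linl a k v : Defs.linearP (fun u => resZ Y om a k u v).
Proof.
rewrite /resZ; apply: (@esum_linear _ _ 0 (fun j u => Y (binop Y om a `|j| u) (j - k) v)).
- by move=> n b x y; rewrite binop_lin Y_linl.
- by move=> u; have [M HM] := resZ_trunc a k u v; exists M => i; rewrite add0r => /HM.
Qed.
Lemma resZ_linr a k u : Defs.linearP (resZ Y om a k u).
Proof.
rewrite /resZ; apply: (@esum_linear _ _ 0 (fun j v => Y (binop Y om a `|j| u) (j - k) v)).
- by move=> n b x y; rewrite Y_linr.
- by move=> v; have [M HM] := resZ_trunc a k u v; exists M => i; rewrite add0r => /HM.
Qed.

(** The mode [u_n] enters [Y(u, log(1+y))] with the factor [y^(-n-1) lam^(-n-1)]; here
    [n = i - k]. *)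
Lemma resYE a k u v M :
  (forall i : nat, (M <= i)%N -> Y u (i%:Z - k) v = 0) ->
  resY Y a k u v = \sum_(i < M) (pow1p a * lamF_pow K (k - i%:Z - 1)) i *: Y u (i%:Z - k) v.
Proof.
move=> HM; have E (i : nat) : psmul (binK a) (lampow K (- (- k + i%:Z) - 1)) `|k + (- k + i%:Z)| *:
    Y u (- k + i%:Z) v = (pow1p a * lamF_pow K (k - i%:Z - 1)) i *: Y u (i%:Z - k) v.
  by rewrite addNKr /= opprD opprK (addrC (- k)).
rewrite /resY (@esumE _ _ _ _ M) => [|i le]; last by rewrite E HM // scaler0.
by apply: eq_bigr => i _; rewrite E.
Qed.

Lemma resY_linl a k v : Defs.linearP (fun u => resY Y a k u v).
Proof.
rewrite /resY; apply: (@esum_linear _ _ (- k)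
  (fun n u => psmul (binK a) (lampow K (- n - 1)) `|k + n| *: Y u n v)).
- by move=> n b x y; rewrite Y_linl scalerDr !scalerA mulrC.
- move=> u; have [M HM] := Y_trunc u v k; exists M => i /HM.
  by rewrite (addrC (- k)) => ->; rewrite scaler0.
Qed.
Lemma resY_linr a k u : Defs.linearP (resY Y a k u).
Proof.
rewrite /resY; apply: (@esum_linear _ _ (- k)
  (fun n v => psmul (binK a) (lampow K (- n - 1)) `|k + n| *: Y u n v)).
- by move=> n b x y; rewrite Y_linr scalerDr !scalerA mulrC.
- move=> v; have [M HM] := Y_trunc u v k; exists M => i /HM.
  by rewrite (addrC (- k)) => ->; rewrite scaler0.
Qed.

End VertexOperators.

(** * Euler identities for the two residues *)

Section CoordinateChange.
Variables (K : numFieldType) (V : lmodType K).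
Variables (Y : V -> int -> V -> V) (one om : V) (c : K).
Hypothesis voa : is_VOA Y one om c.
Local Notation hom := (wt_space Y om).
Local Notation log1pM := (log1pM K).
Let Ylinl := Y_linl voa.
Let Ylinr := Y_linr voa.

(* Zhu's operator [L[0]]; [Y om e] is [L(e-1)]. *)
Definition Lsq0 (v : V) : V := esum 0 (fun e => log1pM (absz e) *: Y om e v).

Lemma Lsq0E v M : (forall e : nat, (M <= e)%N -> Y om e%:Z v = 0) ->
  Lsq0 v = \sum_(e < M) log1pM e *: Y om e%:Z v.
Proof.
move=> HM; rewrite /Lsq0 (@esumE _ _ _ _ M) => [|i le]; last by rewrite add0r HM // scaler0.
by apply: eq_bigr => i _; rewrite add0r.
Qed.

Lemma Lsq0_lin : Defs.linearP Lsq0.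
Proof.
apply: (@esum_linear _ _ 0 (fun e v => log1pM (absz e) *: Y om e v)).
- by move=> n b x y; rewrite Ylinr scalerDr !scalerA mulrC.
- by move=> v; have [M HM] := om_trunc voa v; exists M => i; rewrite add0r => /HM ->; rewrite scaler0.
Qed.

(* Integrating by parts, the residue of [(1+y)^a y^(-k)] against
   [(1+y) log(1+y) F'(y)] is the residue of
   [(1+y)^a y^(-k) (euler_ser a k - 1)] against [F]. *)
Definition euler_ser (a : K) (k : int) : fps K :=
  lamF K * (fps_const k%:~R + fps_const (k%:~R - a - 1) * fpsX).

(** The diagonal entry of the triangular recursion for [D_k]: it adds [k] to the eigenvalue. *)
Lemma euler_ser0 a k : euler_ser a k 0%N = k%:~R.
Proof.
rewrite /euler_ser fps_mulE big_ord1 fps_addE mulrC (mulrC (fps_const _)) fpsXM0 addr0.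
by rewrite /lamF /lam expr0 divr1 mulr1.
Qed.

(** The commutator [[L[0], Y(u,z)]] is the sum over [p] of [l^(p)(z)/p! Y(L(p-1)u, z)], where
    [l = (1+z) log(1+z)]: [om_comm] is applied to each mode in [L[0]], and the numbers [l_e C(e, p)]
    are collected into divided derivatives. *)
Lemma resZ_comm_om a k h u v (X := fun p (i : nat) => Y (Y om p%:Z u) (i%:Z - k) v) :
  hom h u -> exists M0, forall M, (M0 <= M)%N ->
  Lsq0 (resZ Y om a k u v) = resZ Y om a k u (Lsq0 v) +
   \sum_(p < M) \sum_(s < M) (pow1p (a + h%:~R) * (fun q => log1pM (p + q)%N * ('C(p + q, p))%:R) : fps K) s *: X p s.
Proof.
move=> hu.
have [P HP] := om_trunc voa u.
have [E0 HE0] := om_trunc voa v.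
have [M1 HM1] := Y_trunc voa u v k.
have [M2 HM2] := @uniform_bound (fun p i => X p i = 0) P
   (fun p => Y_trunc voa (Y om p%:Z u) v k).
have [M3 HM3] := @uniform_bound (fun e i => Y u (i%:Z - k) (Y om e%:Z v) = 0) E0
   (fun e => Y_trunc voa u (Y om e%:Z v) k).
pose M0 := maxn M1 (maxn M2 M3).
exists (maxn M0 P) => M; rewrite !geq_max => /andP[/and3P[L1 L2 L3] LP].
have X0 p i : (M <= i)%N -> X p i = 0.
  move=> le; case: (ltnP p P) => [pP|/HP]; first by apply: HM2 => //; apply: leq_trans le.
  by move=> E; rewrite /X E (linP0 (Ylinl _ _)).
have Xp p i : (P <= p)%N -> X p i = 0.
  by move=> /HP E; rewrite /X E (linP0 (Ylinl _ _)).
have uv0 i : (M <= i)%N -> Y u (i%:Z - k) v = 0.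
  by move=> le; apply: HM1; apply: leq_trans le.
have uov0 e i : (M <= i)%N -> Y u (i%:Z - k) (Y om e%:Z v) = 0.
  move=> le; case: (ltnP e E0) => [eE|/HE0 ->]; first by apply: HM3 => //; apply: leq_trans le.
  exact: linP0 (Ylinr _ _).
set cc := pow1p (a + h%:~R).
have RE : resZ Y om a k u v = \sum_(i < M) cc i *: Y u (i%:Z - k) v.
  exact: (resZ_hom voa a hu uv0).
have [E1 HE1] := om_trunc voa (resZ Y om a k u v).
(* Besides killing the tails, [E >= M + P] leaves for each [p < P] at least [M] values of
   [q = e - p], as [sum_triangle] demands. *)
pose E := maxn E1 (maxn E0 (M + P)).
have [LE1 LE0 LMP] : [/\ (E1 <= E)%N, (E0 <= E)%N & (M + P <= E)%N].
  by rewrite /E; split; lia.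
have R0 e : (E <= e)%N -> Y om e%:Z (resZ Y om a k u v) = 0.
  by move=> le; apply: HE1; apply: leq_trans le.
have v0 e : (E <= e)%N -> Y om e%:Z v = 0.
  by move=> le; apply: HE0; apply: leq_trans le.
rewrite (Lsq0E R0) (Lsq0E v0).
have omR e : (e < E)%N -> Y om e%:Z (resZ Y om a k u v) = resZ Y om a k u (Y om e%:Z v) +
   \sum_(p < E) \sum_(i < M) (cc i * ('C(e, p))%:R) *: X p (i + (e - p))%N.
  move=> eE; rewrite RE (linP_sum (Ylinr _ _)).
  rewrite (@resZ_hom _ _ _ _ _ _ voa _ _ h _ _ M) //; last by move=> i; apply: uov0.
  rewrite exchange_big -big_split; apply: eq_bigr => i _ /=.
  rewrite (linPZ (Ylinr _ _)) (om_comm voa _ _ _ eE) scalerDr scaler_sumr; congr (_ + _).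
  apply: eq_bigr => p _; rewrite scalerA.
  case: (leqP p e) => [pe|ep]; last by rewrite bin_small // mulr0 !scale0r.
  by rewrite /X; congr (_ *: Y _ _ _); lia.
rewrite (linP_sum (resZ_linr voa _ _ _)).
rewrite (eq_bigr (fun e : 'I_E => resZ Y om a k u (log1pM e *: Y om e%:Z v) +
   \sum_(p < E) \sum_(i < M) (log1pM e * (cc i * ('C(e, p))%:R)) *: X p (i + (e - p))%N)); last first.
  move=> e _; rewrite omR // scalerDr (linPZ (resZ_linr voa _ _ _)); congr (_ + _).
  rewrite scaler_sumr; apply: eq_bigr => p _; rewrite scaler_sumr.
  by apply: eq_bigr => i _; rewrite scalerA.
rewrite big_split; congr (_ + _) => /=.
rewrite exchange_big.
have PE : (P <= E)%N by lia.
pose G p : V := \sum_(e < E) \sum_(i < M) (log1pM e * (cc i * ('C(e, p))%:R)) *: X p (i + (e - p))%N.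
have G0 p : (P <= p)%N -> G p = 0.
  move=> le; rewrite /G big1 // => e _; rewrite big1 // => i _.
  by rewrite Xp // scaler0.
rewrite -[LHS]/(\sum_(p < E) G p) (sum_truncate G0 PE).
pose H p : V := \sum_(s < M) (cc * (fun q => log1pM (p + q)%N * ('C(p + q, p))%:R) : fps K) s *: X p s.
have H0 p : (P <= p)%N -> H p = 0.
  by move=> le; rewrite /H big1 // => s _; rewrite Xp // scaler0.
rewrite -[RHS]/(\sum_(p < M) H p) (sum_truncate H0 LP).
apply: eq_bigr => -[p pP] _ /=; rewrite /G /H.
pose A : fps K := fun q => log1pM (p + q)%N * ('C(p + q, p))%:R.
(* Substitute [e = p + q]; the terms with [e < p] carry a zero binomial. *)
transitivity (\sum_(q < E - p) \sum_(i < M) (A q * cc i) *: X p (q + i)%N).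
  rewrite -(big_mkord xpredT (fun e => \sum_(i < M) (log1pM e * (cc i * ('C(e, p))%:R)) *: X p (i + (e - p))%N)).
  rewrite (big_cat_nat (n := p)) //=; last by lia.
  rewrite big_nat_cond big1 ?add0r; last first.
    move=> e /andP[/andP[_ ep] _]; rewrite big1 // => i _.
    by rewrite bin_small // !mulr0 scale0r.
  rewrite -[X in \sum_(X <= _ < _) _]add0n big_addn big_mkord.
  apply: eq_bigr => q _; apply: eq_bigr => i _.
  rewrite addnK (addnC i) (addnC q p); congr (_ *: _); rewrite /A; ring.
rewrite (@sum_triangle _ _ (fun q i => (A q * cc i) *: X p (q + i)%N)); last by lia.
  apply: eq_bigr => s _; rewrite (mulrC cc) fps_mulE scaler_suml; apply: eq_bigr => q _.
  by rewrite subnKC // -ltnS.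
by move=> q i le; rewrite X0 // scaler0.
Qed.

(** Multiplying the kernel by [y^j] replaces [k] by [k - j], so the sum is a single residue whose
    kernel is multiplied by [euler_ser a k]. *)
Lemma sum_euler_ser_resZ a k h u v : hom h u -> exists M0, forall M, (M0 <= M)%N ->
  \sum_(j < M) euler_ser a k j *: resZ Y om a (k - j%:Z) u v =
  \sum_(s < M) (euler_ser a k * pow1p (a + h%:~R)) s *: Y u (s%:Z - k) v.
Proof.
move=> hu; have [M0 H0] := Y_trunc voa u v k; exists M0 => M M0M.
have uv0 i : (M <= i)%N -> Y u (i%:Z - k) v = 0.
  by move=> le; apply: H0; apply: leq_trans le.
have E (i j : nat) : i%:Z - (k - j%:Z) = (j + i)%N%:Z - k by lia.
rewrite (eq_bigr (fun j : 'I_M => \sum_(i < M) (euler_ser a k j * pow1p (a + h%:~R) i) *: Y u ((j + i)%N%:Z - k) v)).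
  rewrite (@sum_triangle _ _ (fun j i => (euler_ser a k j * pow1p (a + h%:~R) i) *: Y u ((j + i)%N%:Z - k) v)) //.
    apply: eq_bigr => s _; rewrite fps_mulE scaler_suml; apply: eq_bigr => q _.
    by rewrite subnKC // -ltnS.
  by move=> j i le; rewrite uv0 // scaler0.
move=> j _; rewrite (@resZ_hom _ _ _ _ _ _ voa _ _ h _ _ M) //.
  by rewrite scaler_sumr; apply: eq_bigr => i _; rewrite scalerA E.
by move=> i le; rewrite E uv0 // (leq_trans le) ?leq_addl.
Qed.

(** This is [[L[0], Y[u,x]] = Y[L[0]u,x] + x d/dx Y[u,x]] at [x = log(1+y)], with the derivative
    integrated by parts into the factor [euler_ser a k - 1]. In the commutator formula the terms
    [p = 0, 1] give the derivative and the [L(0)] part of [L[0] u]; the terms [p >= 2] give its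
    other parts. *)
Lemma resZ_Lsq0_hom a k h u v : hom h u -> exists M0, forall M, (M0 <= M)%N ->
  Lsq0 (resZ Y om a k u v) = resZ Y om a k (Lsq0 u) v + resZ Y om a k u (Lsq0 v)
   - resZ Y om a k u v + \sum_(j < M) euler_ser a k j *: resZ Y om a (k - j%:Z) u v.
Proof.
move=> hu; have [M1 H1] := resZ_comm_om a k v hu; have [M2 H2] := sum_euler_ser_resZ a k v hu.
have [P HP] := om_trunc voa u.
have [M3 H3] := Y_trunc voa u v k.
have [M4 H4] := @uniform_bound (fun p i => Y (Y om p%:Z u) (i%:Z - k) v = 0) P
   (fun p => Y_trunc voa (Y om p%:Z u) v k).
exists (maxn (maxn M1 M2) (maxn (maxn M3 M4) P)).+2 => -[|[|M]] // LM.
have [L1 L2 L3 [L4 L5]] : [/\ (M1 <= M.+2)%N, (M2 <= M.+2)%N, (M3 <= M)%N & (M4 <= M)%N /\ (P <= M)%N].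
  by split; [| | |split]; lia.
rewrite (H1 _ L1) (H2 _ L2).
have uv0 i : (M.+2 <= i)%N -> Y u (i%:Z - k) v = 0 by move=> le; apply: H3; lia.
have X0 p i : (M.+2 <= i)%N -> Y (Y om p%:Z u) (i%:Z - k) v = 0.
  move=> le; case: (ltnP p P) => [pP|/HP ->]; last exact: (linP0 (Ylinl _ _)).
  by apply: H4 => //; lia.
have u0 e : (M.+2 <= e)%N -> Y om e%:Z u = 0 by move=> le; apply: HP; lia.
set cc := pow1p (a + h%:~R).
have RE : resZ Y om a k u v = \sum_(i < M.+2) cc i *: Y u (i%:Z - k) v.
  exact: (resZ_hom voa a hu uv0).
pose d p : fps K := fun q => log1pM (p + q)%N * ('C(p + q, p))%:R.
pose T p := \sum_(s < M.+2) (cc * d p) s *: Y (Y om p%:Z u) (s%:Z - k) v.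
pose S := \sum_(s < M.+2) (euler_ser a k * cc) s *: Y u (s%:Z - k) v.
have hom1 : Y om 1%:Z u = h%:~R *: u by [].
have E01 : T 0%N + T 1%N = h%:~R *: resZ Y om a k u v - resZ Y om a k u v + S.
  have d0 : d 0%N = log1pM by apply/funext => q; rewrite /d bin0 mulr1.
  have d1 : d 1%N = fpsD log1pM by apply/funext => q; rewrite /d bin1 mulrC.
  (* [L(-1) u] has modes [(L(-1)u)_n = -n u_(n-1)], which shifts the index by one: the first term
     vanishes because [log1pM] has no constant term, and the term added at the end is beyond the
     truncation. *)
  have -> : T 0%N = \sum_(s < M.+2) ((k%:~R - s.+1%:R) * (cc * log1pM) s.+1) *: Y u (s%:Z - k) v.
    rewrite /T d0 big_ord_recl [X in _ + X = _](eq_bigr (fun s : 'I_M.+1 =>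
        ((k%:~R - s.+1%:R) * (cc * log1pM) s.+1) *: Y u (s%:Z - k) v)); last first.
      move=> s _; rewrite lift0 (Y_om0 voa) scalerA mulrC rmorphB opprB.
      by congr (_ *: Y _ _ _); lia.
    rewrite fps_mulE big_ord1 log1pM0 mulr0 scale0r add0r [RHS]big_ord_recr /=.
    by rewrite (H3 M.+1) ?scaler0 ?addr0 //; lia.
  rewrite RE /T d1 /S scaler_sumr -sumrB -!big_split; apply: eq_bigr => s _ /=.
  rewrite hom1 (linPZ (Ylinl _ _)) !scalerA -!scalerDl -scalerBl -scalerDl; congr (_ *: _).
  have /= := pow1p_log1p_coef a h%:~R k s; rewrite -/cc -/(euler_ser a k) fps_addE fps_oppE => E.
  by rewrite -addrA -E; ring.
have ET p : resZ Y om a k (log1pM p.+2 *: Y om p.+2%:Z u) v = T p.+2.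
  have hu2 : hom (h - p.+2%:Z + 1) (Y om p.+2%:Z u) by apply: (hom_om voa).
  rewrite (linPZ (resZ_linl voa _ _ _)) (@resZ_hom _ _ _ _ _ _ voa _ _ _ _ _ M.+2 hu2); last first.
    by move=> i; apply: X0.
  rewrite scaler_sumr /T; apply: eq_bigr => s _; rewrite scalerA; congr (_ *: _).
  (* The factor [(1+z)^(-(p+1))] in the divided derivative is exactly the weight drop from [u] to
     [L(p+1) u]. *)
  have -> : d p.+2 = fps_const (log1pM p.+2) * pow1p (- p.+1%:R).
    by apply/funext => q; rewrite fps_constM -log1pM_divided.
  rewrite (mulrCA cc) fps_constM pow1pMNn; congr (_ * pow1p _ _).
  have -> : h - p.+2%:Z + 1 = h - p.+1%:Z by lia.
  by rewrite rmorphB addrA.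
rewrite (Lsq0E u0) (linP_sum (resZ_linl voa _ _ _)).
rewrite -[X in _ + X = _]/(\sum_(p < M.+2) T p) -[X in _ = _ + X]/S.
have split2 (F : nat -> V) : \sum_(i < M.+2) F i = F 0%N + F 1%N + \sum_(i < M) F i.+2.
  by rewrite (big_ord_recl M.+1) (big_ord_recl M) addrA.
rewrite (split2 T) (split2 (fun p => resZ Y om a k (log1pM p *: Y om p%:Z u) v)).
rewrite (eq_bigr _ (fun (i : 'I_M) _ => ET i)) E01.
rewrite log1pM0 scale0r (linP0 (resZ_linl voa _ _ _)) add0r log1pM1 scale1r hom1.
rewrite (linPZ (resZ_linl voa _ _ _)) (addrC (resZ _ _ _ _ _ (Lsq0 v))) -!addrA.
by congr (_ + _); rewrite [RHS]addrA [RHS]addrC -!addrA.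
Qed.

(** Extension by linearity to sums of homogeneous vectors, such as [zhu_map u]. Stating it for all
    large [M] lets the bounds of several identities be merged. *)
Lemma resZ_Lsq0 a k u v : exists M0, forall M, (M0 <= M)%N ->
  Lsq0 (resZ Y om a k u v) = resZ Y om a k (Lsq0 u) v + resZ Y om a k u (Lsq0 v)
   - resZ Y om a k u v + \sum_(j < M) euler_ser a k j *: resZ Y om a (k - j%:Z) u v.
Proof.
elim/(hom_ind voa): u => [|h u hu|x y [M1 H1] [M2 H2]]; last 2 first.
- exact: resZ_Lsq0_hom hu.
- exists (maxn M1 M2) => M; rewrite geq_max => /andP[L1 L2].
  have E k' w : resZ Y om a k' (x + y) w = resZ Y om a k' x w + resZ Y om a k' y w.
    exact: (linPD (resZ_linl voa a k' w)).
  rewrite (linPD Lsq0_lin) (linPD (resZ_linl voa a k v)) !E (linPD Lsq0_lin) (H1 _ L1) (H2 _ L2).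
  under [in RHS]eq_bigr do rewrite E scalerDr.
  rewrite big_split /= opprD addrACA; congr (_ + _).
  by rewrite addrACA; congr (_ + _); rewrite addrACA.
exists 0%N => M _.
have E k' w : resZ Y om a k' 0 w = 0 by exact: (linP0 (resZ_linl voa a k' w)).
rewrite (linP0 Lsq0_lin) !E (linP0 Lsq0_lin) subr0 !add0r big1 // => j _.
by rewrite E scaler0.
Qed.

(** The same Euler identity for [L(0)] and [Y(u, log(1+y))]: the weight of [u_(s-k) v] is
    [(h1 + h2 - 1) + (k - s)], and [lamF_pow_euler] turns the factor [k - s] into multiplication by
    [euler_ser a k]. *)
Lemma resY_L0 a k h1 h2 u v : hom h1 u -> hom h2 v -> exists M0, forall M, (M0 <= M)%N ->
  Y om 1 (resY Y a k u v) = (h1 + h2 - 1)%:~R *: resY Y a k u v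
     + \sum_(j < M) euler_ser a k j *: resY Y a (k - j%:Z) u v.
Proof.
move=> hu hv; have [M0 H0] := Y_trunc voa u v k; exists M0 => M M0M.
have uv0 i : (M <= i)%N -> Y u (i%:Z - k) v = 0.
  by move=> le; apply: H0; apply: leq_trans le.
have E (i j : nat) : i%:Z - (k - j%:Z) = (j + i)%N%:Z - k by lia.
pose G (j i : nat) := (euler_ser a k j * (pow1p a * lamF_pow K (k - (j + i)%N%:Z - 1)) i) *: Y u ((j + i)%N%:Z - k) v.
rewrite (eq_bigr (fun j : 'I_M => \sum_(i < M) G j i)); last first.
  move=> j _; rewrite (@resYE _ _ _ _ _ _ _ M).
    rewrite scaler_sumr; apply: eq_bigr => i _; rewrite scalerA E /G.
    by congr (_ * (pow1p a * lamF_pow K _) _ *: _); lia.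
  by move=> i le; rewrite E uv0 // (leq_trans le) ?leq_addl.
rewrite (@sum_triangle _ _ G M M) // => [|j i le]; last by rewrite /G uv0 // scaler0.
rewrite (resYE a uv0) (linP_sum (Ylinr _ _)) scaler_sumr -big_split.
apply: eq_bigr => s _ /=.
have -> : \sum_(j < s.+1) G j (s - j)%N = (euler_ser a k * (pow1p a * lamF_pow K (k - s%:Z - 1))) s *: Y u (s%:Z - k) v.
  rewrite [X in X *: _]fps_mulE scaler_suml; apply: eq_bigr => j _.
  by rewrite /G subnKC // -ltnS.
rewrite -lamF_pow_euler (linPZ (Ylinr _ _)).
have /homE -> := hom_Y voa (s%:Z - k) hu hv.
rewrite !scalerA -scalerDl; congr (_ *: _).
rewrite mulrC -mulrDl -rmorphD; congr (_%:~R * _); lia.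
Qed.

End CoordinateChange.

(** * Linear spans and their transport along a bijection *)

Section Span.
Variables (K : fieldType) (V : lmodType K) (S : V -> Prop).

Lemma inspan_add x y : inspan S x -> inspan S y -> inspan S (x + y).
Proof. by elim=> [|z x' a Sz _ IH] Sy; rewrite ?add0r // -addrA; apply: inspanD => //; apply: IH. Qed.
Lemma inspan_scale a x : inspan S x -> inspan S (a *: x).
Proof.
elim=> [|z x' b Sz _ IH]; first by rewrite scaler0; apply: inspan0.
by rewrite scalerDr scalerA; apply: inspanD.
Qed.
Lemma inspan_opp x : inspan S x -> inspan S (- x).
Proof. by rewrite -scaleN1r; apply: inspan_scale. Qed.
Lemma inspan_gen x : S x -> inspan S x.
Proof. by move=> Sx; rewrite -[x]scale1r -[_ *: _]addr0; apply: inspanD => //; apply: inspan0. Qed.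
Lemma inspan_sum (I : Type) (r : seq I) (P : pred I) (F : I -> V) :
  (forall i, P i -> inspan S (F i)) -> inspan S (\sum_(i <- r | P i) F i).
Proof. by move=> H; apply: big_ind => //; [apply: inspan0 | apply: inspan_add]. Qed.
End Span.

Lemma inspan_iff (K : fieldType) (V : lmodType K) (S1 S2 : V -> Prop) (f : V -> V) :
  Defs.linearP f -> injective f -> (forall y, exists x, f x = y) ->
  (forall x, S1 x <-> S2 (f x)) -> forall x, inspan S1 x <-> inspan S2 (f x).
Proof.
move=> lf fI fS H x; split.
  elim=> [|z y a Sz _ IH]; first by rewrite (linP0 lf); apply: inspan0.
  by rewrite lf; apply: inspanD => //; apply/H.
move E : (f x) => y Sy; elim: Sy x E => [x|z y' a Sz _ IH x].
  by rewrite -(linP0 lf) => /fI ->; apply: inspan0.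
have [z' zE] := fS z; have [w wE] := fS y'.
rewrite -zE -wE -lf => /fI ->; apply: inspanD; last exact: IH.
by apply/H; rewrite zE.
Qed.

(** * The intertwining map *)

Section Intertwiner.
Variables (K : numFieldType) (V : lmodType K).
Variables (Y : V -> int -> V -> V) (one om : V) (c : K).
Hypothesis voa : is_VOA Y one om c.
Local Notation hom := (wt_space Y om).
Local Notation log1pM := (log1pM K).
Local Notation Lsq0 := (Lsq0 Y om).
Let Ylinl := Y_linl voa.
Let Ylinr := Y_linr voa.

(* [zhu_coef n] is the part of [f] lowering weights by [n]; the relation
   [f L(0) = L[0] f] says [n f_n = sum_(1 <= j <= n) l_j L(j) f_(n-j)],
   where [l_j] is coefficient [j+1] of [(1+y) log(1+y)]. *)
Fixpoint zhu_coefs (n : nat) (v : V) : seq V :=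
  match n with
  | 0 => [:: v]
  | n'.+1 => let s := zhu_coefs n' v in
      rcons s (n'.+1%:R^-1 *:
        \sum_(j < n'.+1) log1pM j.+2 *: Y om j.+2%:Z (nth 0 s (n' - j)%N))
  end.
Definition zhu_coef n v := nth 0 (zhu_coefs n v) n.

Lemma size_zhu_coefs n v : size (zhu_coefs n v) = n.+1.
Proof. by elim: n => //= n IH; rewrite size_rcons IH. Qed.
Lemma nth_zhu_coefs n v i : (i <= n)%N -> nth 0 (zhu_coefs n v) i = zhu_coef i v.
Proof.
elim: n => [|n IH]; first by rewrite leqn0 => /eqP ->.
rewrite leq_eqVlt => /orP[/eqP->//|]; rewrite ltnS => le.
by rewrite /= nth_rcons size_zhu_coefs ltnS le IH.
Qed.
Lemma zhu_coef0 v : zhu_coef 0 v = v. Proof. by []. Qed.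
Lemma zhu_coefS n v : zhu_coef n.+1 v =
  n.+1%:R^-1 *: \sum_(j < n.+1) log1pM j.+2 *: Y om j.+2%:Z (zhu_coef (n - j)%N v).
Proof.
rewrite /zhu_coef /= nth_rcons size_zhu_coefs ltnn eqxx; congr (_ *: _).
by apply: eq_bigr => j _; rewrite nth_zhu_coefs // leq_subr.
Qed.
Lemma zhu_coef_rec n v :
  n.+1%:R *: zhu_coef n.+1 v = \sum_(j < n.+1) log1pM j.+2 *: Y om j.+2%:Z (zhu_coef (n - j)%N v).
Proof. by rewrite zhu_coefS scalerA divff ?scale1r // pnatr_eq0. Qed.

Lemma zhu_coef_lin n : Defs.linearP (zhu_coef n).
Proof.
elim/ltn_ind: n => -[|n] IH a x y //.
rewrite !zhu_coefS scalerA mulrC -scalerA -scalerDr; congr (_ *: _).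
rewrite scaler_sumr -big_split; apply: eq_bigr => j _ /=.
by rewrite IH ?ltnS ?leq_subr // Ylinr scalerDr !scalerA mulrC.
Qed.

Lemma zhu_coef_hom h n v : hom h v -> hom (h - n%:Z) (zhu_coef n v).
Proof.
move=> hv; elim/ltn_ind: n => -[|n] IH; first by rewrite subr0.
rewrite zhu_coefS; apply: (hom_scale voa).
have H j : (j < n.+1)%N -> hom (h - n.+1%:Z) (log1pM j.+2 *: Y om j.+2%:Z (zhu_coef (n - j)%N v)).
  move=> jn; apply: (hom_scale voa).
  have := hom_om voa j.+2%:Z (IH (n - j)%N ltac:(lia)); congr (hom _ _); lia.
apply: (big_ind (fun x => hom (h - n.+1%:Z) x)).
- by apply/homE; rewrite scaler0 (linP0 (Ylinr _ _)).
- by move=> x y /homE hx /homE hy; apply/homE; rewrite (linPD (Ylinr _ _)) hx hy scalerDr.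
- by move=> j _; apply: H.
Qed.

Lemma zhu_coef_trunc v : exists M, forall n, (M <= n)%N -> zhu_coef n v = 0.
Proof.
have [N HN] := hom_bounded voa.
elim/(hom_ind voa): v => [|h v hv|x y [M1 H1] [M2 H2]].
- by exists 0%N => n _; apply: linP0 (zhu_coef_lin n).
- exists (absz (h - N)).+1 => n le; apply: (HN (h - n%:Z)); [lia | exact: zhu_coef_hom].
- exists (maxn M1 M2) => n; rewrite geq_max => /andP[/H1 E1 /H2 E2].
  by rewrite (linPD (zhu_coef_lin n)) E1 E2 addr0.
Qed.

Definition zhu_map (v : V) : V := esum 0 (fun n => zhu_coef (absz n) v).

Lemma zhu_mapE v M : (forall n, (M <= n)%N -> zhu_coef n v = 0) -> zhu_map v = \sum_(n < M) zhu_coef n v.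
Proof.
move=> HM; rewrite /zhu_map (@esumE _ _ _ _ M) => [|i le]; last by rewrite add0r HM.
by apply: eq_bigr => i _; rewrite add0r.
Qed.

Lemma zhu_map_lin : Defs.linearP zhu_map.
Proof.
apply: (@esum_linear _ _ 0 (fun n v => zhu_coef (absz n) v)) => [n|v]; first exact: zhu_coef_lin.
by have [M HM] := zhu_coef_trunc v; exists M => i; rewrite add0r => /HM.
Qed.

(** For [v] of weight [h], [L(0)] scales [f_n v] by [h - n], and by the recursion the part of [(L[0]
    - L(0)) f v] of weight [h - n] is [n f_n v]; together they give [h f_n v]. *)
Lemma zhu_map_L0 v : zhu_map (Y om 1 v) = Lsq0 (zhu_map v).
Proof.
elim/(hom_ind voa): v => [|h v hv|x y Ex Ey].
- by rewrite (linP0 (Ylinr _ _)) (linP0 zhu_map_lin) (linP0 (Lsq0_lin voa)).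
- have [N HN] := hom_bounded voa.
  have [M0 HM0] := om_trunc voa (zhu_map v).
  pose M := maxn M0 (absz (h - N)).+1.
  have fc_0 n : (M <= n)%N -> zhu_coef n v = 0.
    by move=> le; apply: (HN (h - n%:Z)); [lia | exact: zhu_coef_hom].
  have G0 j n : (M <= j.+1 + n)%N -> Y om j.+2%:Z (zhu_coef n v) = 0.
    move=> le; apply: (HN (h - n%:Z - j.+2%:Z + 1)); first lia.
    by apply: (hom_om voa); apply: zhu_coef_hom.
  have om0 e : (M.+2 <= e)%N -> Y om e%:Z (zhu_map v) = 0 by move=> le; apply: HM0; lia.
  rewrite (Lsq0E om0) (big_ord_recl M.+1) (big_ord_recl M) log1pM0 scale0r add0r log1pM1 scale1r.
  have -> : \sum_(i < M) log1pM (lift ord0 (lift ord0 i)) *: Y om (Posz (lift ord0 (lift ord0 i))) (zhu_map v)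
     = \sum_(n < M) n%:R *: zhu_coef n v.
    rewrite [LHS](eq_bigr (fun j : 'I_M => \sum_(n < M) log1pM j.+2 *: Y om j.+2%:Z (zhu_coef n v))); last first.
      by move=> j _; rewrite !lift0 (zhu_mapE fc_0) (linP_sum (Ylinr _ _)) scaler_sumr.
    pose G j n : V := log1pM j.+2 *: Y om j.+2%:Z (zhu_coef n v).
    rewrite (@sum_triangle _ _ G M M) // => [|j n le]; last first.
      by rewrite /G G0 ?scaler0 // (leq_trans le) // leq_add2r.
    rewrite (eq_bigr (fun s : 'I_M => s.+1%:R *: zhu_coef s.+1 v)) => [|s _]; last by rewrite zhu_coef_rec.
    have -> : \sum_(s < M) s.+1%:R *: zhu_coef s.+1 v = \sum_(n < M.+1) n%:R *: zhu_coef n v.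
      by rewrite [RHS]big_ord_recl scale0r add0r.
    by rewrite big_ord_recr /= fc_0 // scaler0 addr0.
  have /homE -> := hv; rewrite (linPZ zhu_map_lin) (zhu_mapE fc_0) (linP_sum (Ylinr _ _)) scaler_sumr -big_split.
  apply: eq_bigr => n _ /=; have /homE -> := zhu_coef_hom n hv.
  by rewrite -scalerDl rmorphB subrK.
- by rewrite (linPD (Ylinr _ _)) !(linPD zhu_map_lin) Ex Ey (linPD (Lsq0_lin voa)).
Qed.

(** * The weight filtration, and bijectivity of the intertwining map *)

Definition wt_le (s : int) : V -> Prop := inspan (fun x => exists2 k, k <= s & hom k x).

Lemma wt_le_hom k s x : k <= s -> hom k x -> wt_le s x.
Proof. by move=> le hx; apply: inspan_gen; exists k. Qed.
Lemma wt_le_trans s t x : s <= t -> wt_le s x -> wt_le t x.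
Proof.
move=> st; elim=> [|z y a [k ks hz] _ IH]; first exact: inspan0.
by apply: inspanD => //; exists k => //; apply: le_trans st.
Qed.
Lemma wt_le_ex x : exists s, wt_le s x.
Proof.
elim/(hom_ind voa): x => [|h u hu|x y [s Hs] [t Ht]].
- by exists 0; apply: inspan0.
- by exists h; apply: wt_le_hom hu.
- exists (Num.max s t); apply: inspan_add; [apply: wt_le_trans Hs | apply: wt_le_trans Ht]; lia.
Qed.

Lemma wt_le_bounded : exists N : int, forall s x, s < N -> wt_le s x -> x = 0.
Proof.
have [N HN] := hom_bounded voa; exists N => s x sN.
elim=> // z y a [k ks hz] _ ->; rewrite addr0.
by rewrite (HN k z) ?scaler0 //; apply: le_lt_trans sN.
Qed.

(** Weights are bounded below, so a vector that can be pushed down the filtration indefinitely is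
    zero. *)
Lemma wt_le_descend s0 x :
  (forall s, s <= s0 -> wt_le s x -> wt_le (s - 1) x) -> wt_le s0 x -> x = 0.
Proof.
have [N low] := wt_le_bounded => H Hx.
suff D n : wt_le (s0 - n%:Z) x by apply: (low (s0 - (absz (s0 - N)).+1%:Z)) => //; lia.
elim: n => [|n IH]; first by rewrite subr0.
have -> : s0 - n.+1%:Z = s0 - n%:Z - 1 by lia.
by apply: H => //; lia.
Qed.

(** [L(0) - s] kills the part of weight [s], and [L[0] - L(0)] lowers weights. *)
Lemma wt_le_Lsq0 s x : wt_le s x -> wt_le (s - 1) (Lsq0 x - s%:~R *: x).
Proof.
elim=> [|z y a [k ks hz] _ IH].
  by rewrite (linP0 (Lsq0_lin voa)) scaler0 subr0; apply: inspan0.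
have -> : Lsq0 (a *: z + y) - s%:~R *: (a *: z + y) =
   a *: (Lsq0 z - s%:~R *: z) + (Lsq0 y - s%:~R *: y).
  rewrite (Lsq0_lin voa) scalerDr scalerBr !scalerA (mulrC a) opprD.
  by rewrite addrACA.
apply: inspan_add => //; apply: inspan_scale.
have [M HM] := om_trunc voa z.
have HM' e : (M.+2 <= e)%N -> Y om e%:Z z = 0 by move=> le; apply: HM; lia.
rewrite (Lsq0E HM') (big_ord_recl M.+1) (big_ord_recl M) log1pM0 scale0r add0r log1pM1 scale1r.
have /homE -> := hz; rewrite addrAC -scalerBl; apply: inspan_add.
  have [->|ne] := eqVneq k s; first by rewrite subrr scale0r; apply: inspan0.
  by apply: inspan_scale; apply: (wt_le_hom _ hz); lia.
apply: inspan_sum => e _; apply: inspan_scale; rewrite !lift0.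
by apply: (wt_le_hom _ (hom_om voa _ hz)); lia.
Qed.

(** On the layer of weight [t <= s] the operator [L[0]] acts as [t]; since [w - t] is invertible, an
    eigenvector for [w] drops to the next layer. *)
Lemma wt_le_eigen s w x : s < w -> wt_le s x -> Lsq0 x = w%:~R *: x -> x = 0.
Proof.
move=> sw Hx Ex; apply: (@wt_le_descend s) Hx => t ts Ht.
have := wt_le_Lsq0 Ht; rewrite Ex -scalerBl -rmorphB => /(inspan_scale ((w - t)%:~R^-1)).
by rewrite scalerA mulVf ?scale1r // intr_eq0; lia.
Qed.

(** The term [n = 0] of [zhu_map] is the identity and the others lower weights. Thus [zhu_map] is
    unipotent for the filtration, whence its bijectivity. *)
Lemma wt_le_zhu_map_sub s x : wt_le s x -> wt_le (s - 1) (zhu_map x - x).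
Proof.
elim=> [|z y a [k ks hz] _ IH].
  by rewrite (linP0 zhu_map_lin) subr0; apply: inspan0.
have -> : zhu_map (a *: z + y) - (a *: z + y) = a *: (zhu_map z - z) + (zhu_map y - y).
  by rewrite zhu_map_lin scalerBr opprD addrACA.
apply: inspan_add => //; apply: inspan_scale.
have [M HM] := zhu_coef_trunc z.
have HM' n : (M.+1 <= n)%N -> zhu_coef n z = 0 by move=> le; apply: HM; lia.
rewrite (zhu_mapE HM') big_ord_recl zhu_coef0 addrAC subrr add0r.
by apply: inspan_sum => n _; apply: (wt_le_hom _ (zhu_coef_hom _ hz)); rewrite lift0; lia.
Qed.

Lemma wt_le_zhu_map s x : wt_le s x -> wt_le s (zhu_map x).
Proof.
move=> H; rewrite -(subrK x (zhu_map x)); apply: inspan_add => //.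
by apply: wt_le_trans (wt_le_zhu_map_sub H); lia.
Qed.

Lemma zhu_map_inj : injective zhu_map.
Proof.
move=> x y E; apply/eqP; rewrite -subr_eq0; apply/eqP.
have E0 : zhu_map (x - y) = 0 by rewrite (linPD zhu_map_lin) (linPN zhu_map_lin) E subrr.
have [s Hs] := wt_le_ex (x - y); apply: (@wt_le_descend s) Hs => t _ Ht.
by have := inspan_opp (wt_le_zhu_map_sub Ht); rewrite E0 sub0r opprK.
Qed.

(** Induction up the filtration, starting at [N - 1] where it is zero: the error [zhu_map z - z]
    lies one layer lower and already has a preimage. *)
Lemma zhu_map_surj y : exists x, zhu_map x = y.
Proof.
have [N low] := wt_le_bounded.
have [s Hs] := wt_le_ex y.
suff D n : forall z, wt_le (N - 1 + n%:Z) z -> exists x, zhu_map x = z.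
  by apply: (D (absz (s - N)).+1); apply: wt_le_trans Hs; lia.
elim: n => [|n IH] z Hz.
  by exists 0; rewrite (linP0 zhu_map_lin) (low _ z _ Hz) //; lia.
have [|x Ex] := IH (zhu_map z - z).
  by apply: wt_le_trans (wt_le_zhu_map_sub Hz); lia.
by exists (z - x); rewrite (linPD zhu_map_lin) (linPN zhu_map_lin) Ex subKr.
Qed.

(** * The intertwining map carries one residue to the other *)

Lemma resZ_wt_le a k p q u v : wt_le p u -> wt_le q v -> wt_le (p + q + k - 1) (resZ Y om a k u v).
Proof.
move=> Hu Hv; elim: Hu => [|z y b [h hp hz] _ IH].
  by rewrite (linP0 (resZ_linl voa a k v)); apply: inspan0.
rewrite (resZ_linl voa); apply: inspan_add => //; apply: inspan_scale.
elim: Hv {IH} => [|w y' b' [h' hq hw] _ IH].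
  by rewrite (linP0 (resZ_linr voa a k z)); apply: inspan0.
rewrite (resZ_linr voa); apply: inspan_add => //; apply: inspan_scale.
have [M HM] := Y_trunc voa z w k.
rewrite (resZ_hom voa a hz HM); apply: inspan_sum => i _; apply: inspan_scale.
by apply: (wt_le_hom _ (hom_Y voa _ hz hw)); lia.
Qed.

(** Both kernels have constant coefficient 1, so both residues have the same term [Y u (-k) v] of
    highest weight. *)
Lemma wt_le_top_term h1 h2 u v k (b : nat -> K) M : hom h1 u -> hom h2 v -> b 0%N = 1 ->
  wt_le (h1 + h2 + k - 2) (\sum_(i < M.+1) b i *: Y u (i%:Z - k) v - Y u (- k) v).
Proof.
move=> hu hv b0; rewrite big_ord_recl b0 scale1r.
have -> : Posz (@ord0 M) - k = - k by rewrite sub0r.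
rewrite (addrAC (Y _ _ _)) subrr add0r; apply: inspan_sum => i _; apply: inspan_scale; rewrite lift0.
by apply: (wt_le_hom _ (hom_Y voa _ hu hv)); lia.
Qed.

Lemma resZ_low a u v : exists k0 : int, forall k, k <= k0 -> resZ Y om a k u v = 0.
Proof.
elim/(hom_ind voa): u => [|h u hu|x y [k1 H1] [k2 H2]].
- by exists 0 => k _; apply: (linP0 (resZ_linl voa a k v)).
- have [M HM] := Y_trunc voa u v 0; exists (- M%:Z) => k le.
  rewrite (@resZ_hom _ _ _ _ _ _ voa a k h u v 0%N) ?big_ord0 // => i _.
  have -> : i%:Z - k = (i + absz k)%N%:Z - 0 by lia.
  by apply: HM; lia.
- exists (Num.min k1 k2) => k le.
  by rewrite (linPD (resZ_linl voa a k v)) H1 ?H2 ?addr0 //; lia.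
Qed.

Lemma resY_low a u v : exists k0 : int, forall k, k <= k0 -> resY Y a k u v = 0.
Proof.
have [M HM] := Y_trunc voa u v 0; exists (- M%:Z) => k le.
rewrite (@resYE _ _ Y a k u v 0%N) ?big_ord0 // => i _.
have -> : i%:Z - k = (i + absz k)%N%:Z - 0 by lia.
by apply: HM; lia.
Qed.

Lemma zhu_map_res_hom a k h1 h2 u v : hom h1 u -> hom h2 v ->
  zhu_map (resY Y a k u v) = resZ Y om a k (zhu_map u) (zhu_map v).
Proof.
move=> hu hv.
pose D k := zhu_map (resY Y a k u v) - resZ Y om a k (zhu_map u) (zhu_map v).
suff D0 : D k = 0 by apply/eqP; rewrite -subr_eq0; apply/eqP.
have [k1 H1] := resY_low a u v; have [k2 H2] := resZ_low a (zhu_map u) (zhu_map v).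
pose k0 := Num.min k1 k2.
(* For [k <= k0] both residues vanish; the induction climbs from there. *)
suff Dn (n : nat) : forall k, k <= k0 + n%:Z -> D k = 0.
  by apply: (Dn (absz (k - k0))); lia.
elim: n {k} => [|n IH] k le.
  by rewrite /D H1 ?H2 ?(linP0 zhu_map_lin) ?subrr //; lia.
have [M1 R1] := resY_L0 voa a k hu hv.
have [M2 R2] := resZ_Lsq0 voa a k (zhu_map u) (zhu_map v).
pose M := maxn M1 M2.
have {}R1 := R1 M.+1 ltac:(lia); have {}R2 := R2 M.+1 ltac:(lia).
(* Subtracting the two Euler identities leaves a combination of the [D (k - j)]; those with [j >= 1]
   vanish by induction and [j = 0] contributes [k D k]. *)
have Leig : Lsq0 (D k) = (h1 + h2 + k - 1)%:~R *: D k.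
  have /homE Eu := hu; have /homE Ev := hv.
  rewrite -!zhu_map_L0 Eu Ev !(linPZ zhu_map_lin) (linPZ (resZ_linl voa a k _)) (linPZ (resZ_linr voa a k _)) in R2.
  rewrite {1}/D (linPD (Lsq0_lin voa)) (linPN (Lsq0_lin voa)) -zhu_map_L0 R1 R2.
  rewrite (linPD zhu_map_lin) (linPZ zhu_map_lin) (linP_sum zhu_map_lin).
  have ES : \sum_(i < M.+1) zhu_map (euler_ser a k i *: resY Y a (k - i%:Z) u v) =
     \sum_(i < M.+1) euler_ser a k i *: resZ Y om a (k - i%:Z) (zhu_map u) (zhu_map v) + k%:~R *: D k.
    rewrite big_ord_recl [in RHS]big_ord_recl euler_ser0 (linPZ zhu_map_lin) addrAC.
    have -> : k - Posz (@ord0 M) = k by rewrite subr0.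
    rewrite scalerBr addrCA subrr addr0; congr (_ + _); apply: eq_bigr => j _.
    rewrite (linPZ zhu_map_lin); congr (_ *: _); apply/eqP; rewrite -subr_eq0; apply/eqP.
    by apply: IH; rewrite lift0; lia.
  rewrite ES /D.
  have alg (x y z w : V) (p q r t : K) : p + q - 1 = r -> t = r + k%:~R ->
      r *: x + (z + k%:~R *: (x - y)) - (p *: y + q *: y - y + z) = t *: (x - y).
    move=> <- ->; rewrite -[X in _ - X + _]scale1r -scalerDl -scalerBl.
    by rewrite opprD addrACA (addrC z) addrK -scalerBr -scalerDl.
  apply: alg; [exact: 0 | | ]; rewrite ?rmorphB ?rmorphD /=; ring.
(* The term [Y u (-k) v], of the highest weight [h1 + h2 + k - 1], cancels in [D k], which therefore
   lies one layer below its eigenvalue. *)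
apply: (@wt_le_eigen (h1 + h2 + k - 2) (h1 + h2 + k - 1)) => //; first lia.
have [M0 HM0] := Y_trunc voa u v k.
have HM i : (M0.+1 <= i)%N -> Y u (i%:Z - k) v = 0 by move=> ?; apply: HM0; lia.
have FY : wt_le (h1 + h2 + k - 2) (resY Y a k u v - Y u (- k) v).
  rewrite (resYE a HM).
  apply: (@wt_le_top_term _ _ _ _ _ (fun i => (pow1p a * lamF_pow K (k - i%:Z - 1)) i)) => //.
  by rewrite fps_mulE big_ord1 /pow1p binK0 mul1r lamF_pow_coef0.
have FZ : wt_le (h1 + h2 + k - 2) (resZ Y om a k u v - Y u (- k) v).
  by rewrite (resZ_hom voa a hu HM); apply: wt_le_top_term => //; rewrite /pow1p binK0.
have Hu : wt_le h1 u by apply: wt_le_hom hu.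
have Hv : wt_le h2 v by apply: wt_le_hom hv.
(* A telescoping sum in which each difference lowers the weight by at least one. *)
have -> : D k = (zhu_map (resY Y a k u v) - resY Y a k u v) + (resY Y a k u v - Y u (- k) v)
    - (resZ Y om a k u v - Y u (- k) v)
    - (resZ Y om a k (zhu_map u - u) (zhu_map v) + resZ Y om a k u (zhu_map v - v)).
  rewrite (linPD (resZ_linl voa a k _)) (linPN (resZ_linl voa a k _)).
  rewrite (linPD (resZ_linr voa a k _)) (linPN (resZ_linr voa a k _)).
  have alg (A R y Z W X : V) : A - X = (A - R) + (R - y) - (Z - y) - ((X - W) + (W - Z)).
    by rewrite (addrA (A - R)) subrK (addrA (X - W)) subrK !opprB (addrA (A - y)) subrK (addrA (A - Z)) subrK.
  exact: alg.
have FR : wt_le (h1 + h2 + k - 1) (resY Y a k u v).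
  rewrite -(subrK (Y u (- k) v) (resY Y a k u v)); apply: inspan_add.
    by apply: wt_le_trans FY; lia.
  by apply: (wt_le_hom _ (hom_Y voa _ hu hv)); lia.
apply: inspan_add; last apply: inspan_opp; first apply: inspan_add.
- by apply: inspan_add => //; apply: wt_le_trans (wt_le_zhu_map_sub FR); lia.
- exact: inspan_opp.
- apply: inspan_add.
    by apply: wt_le_trans (resZ_wt_le a k (wt_le_zhu_map_sub Hu) (wt_le_zhu_map Hv)); lia.
  by apply: wt_le_trans (resZ_wt_le a k Hu (wt_le_zhu_map_sub Hv)); lia.
Qed.

Lemma zhu_map_res a k u v : zhu_map (resY Y a k u v) = resZ Y om a k (zhu_map u) (zhu_map v).
Proof.
elim/(hom_ind voa): u => [|h1 u hu|x y Hx Hy]; last 2 first.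
- elim/(hom_ind voa): v => [|h2 v hv|x y Hx Hy]; last 2 first.
  + exact: zhu_map_res_hom hu hv.
  + rewrite (linPD (resY_linr voa a k u)) !(linPD zhu_map_lin) Hx Hy.
    by rewrite (linPD (resZ_linr voa a k _)).
  by rewrite (linP0 (resY_linr voa a k u)) !(linP0 zhu_map_lin) (linP0 (resZ_linr voa a k _)).
- rewrite (linPD (resY_linl voa a k v)) !(linPD zhu_map_lin) Hx Hy.
  by rewrite (linPD (resZ_linl voa a k _)).
by rewrite (linP0 (resY_linl voa a k v)) !(linP0 zhu_map_lin) (linP0 (resZ_linl voa a k _)).
Qed.

(** * Compatibility with the vacuum, the derivation and the automorphism *)

Lemma zhu_map_one : zhu_map one = one.
Proof.
(* Each mode [om_e] with [e >= 0] kills the vacuum, so the vacuum receives no correction. *)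
have H n : (1 <= n)%N -> zhu_coef n one = 0.
  elim/ltn_ind: n => -[|n] IH // _; rewrite zhu_coefS big1 ?scaler0 // => -[j jn] _ /=.
  have [->|ne] := eqVneq j n; first by rewrite subnn zhu_coef0 (Y_one_ge0 voa) // scaler0.
  by rewrite IH ?(linP0 (Ylinr _ _)) ?scaler0 //; lia.
by rewrite (zhu_mapE H) big_ord1.
Qed.

Lemma Y_om0_one u : Y om 0 u = Y u (-2) one.
Proof.
have := Y_om0 voa u (-1) one; rewrite (Y_one voa) => ->.
by rewrite opprK scale1r.
Qed.

Lemma zhu_map_Dop u : zhu_map (Dop Y one u) = Lop Y om (-1) (zhu_map u) + Lop Y om 0 (zhu_map u).
Proof.
have H w (i : nat) : (2 <= i)%N -> Y w (i%:Z - 2) one = 0.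
  by move=> le; apply: (Y_one_ge0 voa); lia.
have S2 (F : nat -> V) : \sum_(i < 2) F i = F 0%N + F 1%N.
  by rewrite !big_ord_recl big_ord0 addr0.
(* Written as a residue, the derivation falls under [zhu_map_res]. On the other side the modes [-2]
   and [-1] of the same residue give [L(-1)] and [L(0)]. *)
have -> : Dop Y one u = resY Y 0 2 u one.
  rewrite (resYE 0 (H u)) pow1p0 (S2 (fun i => (1 * lamF_pow K (2 - i%:Z - 1)) i *: Y u (i%:Z - 2) one)).
  by rewrite !mul1r lamF_pow_coef0 scale1r [lamF_pow K _ _](_ : _ = 0) // scale0r addr0.
rewrite zhu_map_res zhu_map_one.
have H2 w i : (2 <= i)%N -> Y (binop Y om 0 i w) (i%:Z - 2) one = 0 by move=> ?; apply: H.
rewrite (resZE (H2 _)) (S2 (fun i => Y (binop Y om 0 i (zhu_map u)) (i%:Z - 2) one)).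
rewrite /binop /= fact0 invr1 !scale1r subr0 scale0r addr0.
rewrite (_ : 1%:Z - 2 = -1) // (Y_one voa) (_ : 0%:Z - 2 = -2) // -Y_om0_one.
by [].
Qed.

(** [zhu_map] is built from modes of [om], and these commute with an automorphism fixing [om]; hence
    the projections onto the spaces [V^r] are respected. *)
Lemma zhu_map_comm (g : V -> V) : Defs.linearP g ->
  (forall u n v, g (Y u n v) = Y (g u) n (g v)) -> g om = om ->
  forall v, zhu_map (g v) = g (zhu_map v).
Proof.
move=> lg gY gom v.
have E n : zhu_coef n (g v) = g (zhu_coef n v).
  elim/ltn_ind: n => -[|n] IH //; rewrite !zhu_coefS (linPZ lg) (linP_sum lg); congr (_ *: _).
  apply: eq_bigr => j _; rewrite (linPZ lg) gY gom IH // ltnS; exact: leq_subr.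
have [M HM] := zhu_coef_trunc v.
rewrite (zhu_mapE HM) (linP_sum lg) (@zhu_mapE _ M) => [|n le]; last by rewrite E HM // (linP0 lg).
by apply: eq_bigr.
Qed.

End Intertwiner.

(** * Transport of the spaces and products *)

Section Transport.
Variables (K : fieldType) (V : lmodType K).
Variables (Y : V -> int -> V -> V) (one om : V).
Variables (g : V -> V) (T : nat) (zeta : K) (f : V -> V).
Hypotheses (lf : Defs.linearP f) (fI : injective f) (fS : forall y, exists x, f x = y).
Hypothesis f_res : forall a k u v, f (resY Y a k u v) = resZ Y om a k (f u) (f v).
Hypothesis f_g : forall v, f (g v) = g (f v).
Hypothesis f_D : forall u, f (Dop Y one u) = Lop Y om (-1) (f u) + Lop Y om 0 (f u).

Lemma f_gproj r u : f (gproj g T zeta r u) = gproj g T zeta r (f u).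
Proof.
rewrite /gproj (linPZ lf) (linP_sum lf); congr (_ *: _); apply: eq_bigr => j _.
rewrite (linPZ lf); congr (_ *: _); elim: (nat_of_ord j) => //= i <-; exact: f_g.
Qed.

(** Both products use the same binomials and exponents, the factor [(1+z)^(wt u)] being part of
    [resZ]; only the residues and the projections have to be transported. *)
Lemma f_bul nn mm pp u v :
  f (bul Y g T zeta nn mm pp u v) = star Y om g T zeta nn mm pp (f u) (f v).
Proof.
rewrite /bul /star /gprod (linP_sum lf); apply: eq_bigr => r _.
case: ifP => _; last exact: linP0.
rewrite (linP_sum lf); apply: eq_bigr => i _.
by rewrite (linPZ lf) f_res f_gproj.
Qed.

Lemma f_dia nn mm u v : f (dia Y g T zeta nn mm u v) = circ Y om g T zeta nn mm (f u) (f v).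
Proof.
rewrite /dia /circ /gcirc (linP_sum lf); apply: eq_bigr => r _.
by rewrite f_res f_gproj.
Qed.

(** Generators go to generators, and surjectivity of [f] writes every generator of the target as an
    image. *)
Lemma tO1_iff nn mm x : tO1 Y one g T zeta nn mm x <-> O1 Y om g T zeta nn mm (f x).
Proof.
apply: inspan_iff => // {}x; split; case.
- by case=> u [v ->]; left; exists (f u), (f v); rewrite f_dia.
- by case=> u ->; right; exists (f u); rewrite (linPD lf) (linPZ lf) f_D.
- case=> u [v]; have [u' <-] := fS u; have [v' <-] := fS v.
  by rewrite -f_dia => /fI ->; left; exists u', v'.
- case=> u; have [u' <-] := fS u; rewrite -f_D -(linPZ lf) -(linPD lf) => /fI ->.
  by right; exists u'.
Qed.

Lemma tO_iff nn mm x : tO Y one g T zeta nn mm x <-> OO Y om g T zeta nn mm (f x).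
Proof.
apply: inspan_iff => // {}x; split; case; [|case|  |case].
- by move=> /tO1_iff; left.
- case=> p1 [p2 [p3 [u [a [b [cc ->]]]]]]; right; left.
  exists p1, p2, p3, (f u), (f a), (f b), (f cc).
  by rewrite f_bul (linPD lf) (linPN lf) !f_bul.
- case=> p1 [p2 [a [y [b [/tO1_iff Oy ->]]]]]; right; right.
  by exists p1, p2, (f a), (f y), (f b); rewrite !f_bul.
- by move=> /tO1_iff; left.
- case=> p1 [p2 [p3 [u [a [b [cc]]]]]]; right; left.
  have [u' uE] := fS u; have [a' aE] := fS a; have [b' bE] := fS b; have [c' cE] := fS cc.
  exists p1, p2, p3, u', a', b', c'; apply: fI.
  by rewrite f_bul (linPD lf) (linPN lf) !f_bul uE aE bE cE.
- case=> p1 [p2 [a [y [b [Oy xE]]]]]; right; right.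
  have [a' aE] := fS a; have [b' bE] := fS b; have [y' yE] := fS y.
  exists p1, p2, a', y', b'; split; first by apply/tO1_iff; rewrite yE.
  by apply: fI; rewrite !f_bul aE bE yE.
Qed.

Lemma quot_iso_span (P1 P2 : V -> Prop) :
  (forall x, inspan P1 x <-> inspan P2 (f x)) -> quot_iso (inspan P1) (inspan P2) f.
Proof.
move=> H; split=> //; try by move=> x /H.
by move=> y; have [x <-] := fS y; exists x; rewrite subrr; apply: inspan0.
Qed.

Lemma alg_iso_f nn : alg_iso (tOn Y one g T zeta nn) (On Y om g T zeta nn)
   (bul Y g T zeta nn nn nn) (star Y om g T zeta nn nn nn) f.
Proof.
split; first by apply: quot_iso_span => x; apply: tO1_iff.
by move=> u v; rewrite f_bul subrr; apply: inspan0.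
Qed.

Lemma bimod_iso_f nn mm : bimod_iso (tO Y one g T zeta nn mm) (OO Y om g T zeta nn mm)
   (bul Y g T zeta nn mm nn) (bul Y g T zeta nn mm mm)
   (star Y om g T zeta nn mm nn) (star Y om g T zeta nn mm mm) f f f.
Proof.
split; first by apply: quot_iso_span => x; apply: tO_iff.
- by move=> u v; rewrite f_bul subrr; apply: inspan0.
- by move=> u v; rewrite f_bul subrr; apply: inspan0.
Qed.
End Transport.

Theorem theorem8p8 (K : numClosedFieldType) (V : lmodType K)
    (Y : V -> int -> V -> V) (one om : V) (c : K)
    (g : V -> V) (T : nat) (zeta : K) :
  is_VOA Y one om c ->
  is_VOA_automorphism Y one om g ->
  has_order g T ->
  T.-primitive_root zeta ->
  forall nn mm : nat,
    (* (1)  tilde A_{g,n}(V,omega)  ~=  A_{g,n}(V,omega) *)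
    (exists f : V -> V,
       alg_iso (tOn Y one g T zeta nn) (On Y om g T zeta nn)
               (bul Y g T zeta nn nn nn) (star Y om g T zeta nn nn nn) f)
    /\
    (* (2)  tilde A_{g,n,m}(V,omega)  ~=  A_{g,n,m}(V,omega) as bimodules *)
    (exists fn fm h : V -> V,
       [/\ alg_iso (tOn Y one g T zeta nn) (On Y om g T zeta nn)
                   (bul Y g T zeta nn nn nn) (star Y om g T zeta nn nn nn) fn,
           alg_iso (tOn Y one g T zeta mm) (On Y om g T zeta mm)
                   (bul Y g T zeta mm mm mm) (star Y om g T zeta mm mm mm) fm &
           bimod_iso (tO Y one g T zeta nn mm) (OO Y om g T zeta nn mm)
                     (bul Y g T zeta nn mm nn) (bul Y g T zeta nn mm mm)
                     (star Y om g T zeta nn mm nn) (star Y om g T zeta nn mm mm)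
                     fn fm h]).
Proof.
move=> voa [lg _ gY _ gom] _ _ nn mm.
have lf := zhu_map_lin voa; have fI := @zhu_map_inj _ _ _ _ _ _ voa; have fS := zhu_map_surj voa.
have f_res := zhu_map_res voa; have f_D := zhu_map_Dop voa.
have f_g := zhu_map_comm voa lg gY gom.
split; first by exists (zhu_map Y om); apply: alg_iso_f.
(* The map depends on neither [nn] nor [mm], so it serves for both algebras and for the bimodule. *)
exists (zhu_map Y om), (zhu_map Y om), (zhu_map Y om).
by split; [apply: alg_iso_f | apply: alg_iso_f | apply: bimod_iso_f].
Qed.
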